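(* Let $C$ be the group with generators $u_1,\dots,u_{27}$ and relations (R1)–(R4) below, and let $\psi_C\colon C\to S_{18}$ be the homomorphism sending $u_j$ to the transposition $(\alpha\,\beta)$, where $\{\alpha,\beta\}$ is the pair of endpoints of edge $j$ of $T$. Then: (i) $\psi_C$ is surjective. The subgroup $\langle u_j : j\in T_0\rangle$, where $T_0=\{5,6,8,9,11,12,14,16,18,19,20,21,22,24,25,26,27\}$ is a spanning tree of $T$, is mapped isomorphically onto $S_{18}$ by $\psi_C$. Hence $C=S_{18}\ltimes K_C$ with $K_C=\ker\psi_C$. (ii) Let $H$ be the group generated by $x_1,\dots,x_{18},y_1,\dots,y_{18},z$ with relations $[x_i,x_j]=[y_i,y_j]=[x_i,y_j]=1$ for all $i\neq j$, $[x_i,y_i]=z$ for all $i$, and $z$ central. Let $\mathrm{ab}\colon H\to\mathbb{Z}^2=\langle x\rangle\times\langle y\rangle$ be given by $x_i\mapsto x$, $y_i\mapsto y$, $z\mapsto 1$. Then $K_C\cong\ker(\mathrm{ab})$. Moreover $C\cong S_{18}\ltimes\ker(\mathrm{ab})$, where $\sigma\in S_{18}$ acts by $x_i\mapsto x_{\sigma(i)}$, $y_i\mapsto y_{\sigma(i)}$, $z\mapsto z$, and under this isomorphism $\psi_C$ corresponds to the projection onto $S_{18}$. (iii) In particular, $K_C$ is a central extension of $\mathbb{Z}^{34}$ by $\mathbb{Z}=\langle z\rangle$, and the center of $C$ is the infinite cyclic group $\langle z\rangle$.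
   Context: Let $T$ be the graph with vertex set $\{1,\dots,18\}$ and 27 edges labelled $1,\dots,27$. Edge $j$ joins the two vertices listed after it: 1:$\{2,7\}$, 2:$\{1,13\}$, 3:$\{4,9\}$, 4:$\{1,3\}$, 5:$\{1,5\}$, 6:$\{2,3\}$, 7:$\{2,6\}$, 8:$\{3,10\}$, 9:$\{4,6\}$, 10:$\{4,5\}$, 11:$\{5,8\}$, 12:$\{6,14\}$, 13:$\{7,15\}$, 14:$\{7,11\}$, 15:$\{8,12\}$, 16:$\{8,16\}$, 17:$\{9,11\}$, 18:$\{9,17\}$, 19:$\{10,12\}$, 20:$\{10,18\}$, 21:$\{11,12\}$, 22:$\{13,15\}$, 23:$\{13,17\}$, 24:$\{14,18\}$, 25:$\{14,16\}$, 26:$\{15,16\}$, 27:$\{17,18\}$. (Geometrically, the vertices of $T$ are the 18 planes and the edges are the 27 intersection lines of a degeneration of $\mathbb{T}\times\mathbb{T}$, for $\mathbb{T}$ a complex torus, into a union of planes. This triangulates a torus with 9 vertices $V_1,\dots,V_9$, each lying on 6 lines.) Nine hexagons in $T$ are given by ordered 6-tuples of edges $(a_r,b_r,c_r,d_r,e_r,f_r)$, $r=1,\dots,9$: $V_1$: $(2,4,6,1,13,22)$; $V_2$: $(1,7,9,3,17,14)$; $V_3$: $(3,10,5,2,23,18)$; $V_4$: $(11,15,19,8,4,5)$; $V_5$: $(8,20,24,12,7,6)$; $V_6$: $(12,25,16,11,10,9)$; $V_7$: $(26,13,14,21,15,16)$; $V_8$: $(21,17,18,27,20,19)$; $V_9$: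 $(27,23,22,26,25,24)$. In each tuple, cyclically consecutive edges share an endpoint, so the six edges form a 6-cycle in $T$. The group $C$ is generated by $u_1,\dots,u_{27}$ with the relations: (R1) $u_j^2=1$ for all $j$; (R2) $u_iu_j=u_ju_i$ whenever edges $i$ and $j$ have no common endpoint; (R3) $u_iu_ju_i=u_ju_iu_j$ whenever $i\neq j$ and edges $i,j$ share an endpoint; (R4) for each $r=1,\dots,9$: $u_{a_r}u_{b_r}u_{c_r}u_{d_r}u_{e_r}=u_{b_r}u_{c_r}u_{d_r}u_{e_r}u_{f_r}$. *)

(* Defs.v *)
(* Abstract (possibly infinite) groups are given by an
   explicit record with the group axioms; finitely presented groups are
   characterised by their universal property. *)
From mathcomp Require Import all_boot all_order all_algebra all_fingroup.
Set Implicit Arguments. Unset Strict Implicit. Unset Printing Implicit Defensive.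

Record agroup := AGroup {
  gcar :> Type;
  gmul : gcar -> gcar -> gcar;
  gone : gcar;
  ginv : gcar -> gcar;
  gmulA : forall a b c, gmul a (gmul b c) = gmul (gmul a b) c;
  gmul1 : forall a, gmul gone a = a;
  gmulV : forall a, gmul (ginv a) a = gone }.

Arguments gmul {_}. Arguments gone {_}. Arguments ginv {_}.
Notation "a ** b" := (gmul a b) (at level 40, left associativity).

Definition ghom (G G' : agroup) (f : G -> G') : Prop :=
  forall a b : G, f (a ** b) = f a ** f b.

Definition gker (G G' : agroup) (f : G -> G') : G -> Prop := fun a => f a = gone.

Definition gcomm (G : agroup) (a b : G) : G := ginv a ** ginv b ** a ** b.

Fixpoint gpown (G : agroup) (a : G) (n : nat) : G :=
  match n with O => gone | S n => gpown a n ** a end.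
Definition gpow (G : agroup) (a : G) (n : int) : G :=
  match n with Posz m => gpown a m | Negz m => ginv (gpown a m.+1) end.

Inductive gen_sub (G : agroup) (S : G -> Prop) : G -> Prop :=
| gen_one : gen_sub S gone
| gen_in  : forall a, S a -> gen_sub S a
| gen_mul : forall a b, gen_sub S a -> gen_sub S b -> gen_sub S (a ** b)
| gen_inv : forall a, gen_sub S a -> gen_sub S (ginv a).

Definition central (G : agroup) (a : G) : Prop := forall b : G, a ** b = b ** a.

Definition iso_on (G G' : agroup) (f : G -> G') (A : G -> Prop) (B : G' -> Prop) : Prop :=
  [/\ (forall a b, A a -> A b -> f (a ** b) = f a ** f b),
      (forall a, A a -> B (f a)),
      (forall a b, A a -> A b -> f a = f b -> a = b) &
      (forall b, B b -> exists a, A a /\ f a = b)].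

Definition PermGroup : agroup :=
  @AGroup {perm 'I_18} (fun s t => (s * t)%g) 1%g (fun s => s^-1)%g
    (@mulgA _) (@mul1g _) (@mulVg _).

Definition ZmodGroup (V : zmodType) : agroup :=
  @AGroup V (fun a b => (a + b)%R) 0%R (fun a => (- a)%R)
    (@GRing.addrA V) (@GRing.add0r V) (@GRing.addNr V).

Definition Z2 : agroup := ZmodGroup 'rV[int]_2.
Definition Z34 : agroup := ZmodGroup 'rV[int]_34.
Definition xZ : 'rV[int]_2 := delta_mx ord0 ord0.
Definition yZ : 'rV[int]_2 := delta_mx ord0 (inord 1).

(* edge j (1-based) joins the two (1-based) vertices listed *)
Definition edges : seq (nat * nat) :=
  [:: (2,7); (1,13); (4,9); (1,3); (1,5); (2,3); (2,6); (3,10); (4,6);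
      (4,5); (5,8); (6,14); (7,15); (7,11); (8,12); (8,16); (9,11); (9,17);
      (10,12); (10,18); (11,12); (13,15); (13,17); (14,18); (14,16);
      (15,16); (17,18)].

(* vertex v (1-based) as an element of 'I_18 (i.e. vertex v is v-1) *)
Definition vtx (v : nat) : 'I_18 := inord v.-1.
(* edge k (1-based) as an element of 'I_27 *)
Definition edg (k : nat) : 'I_27 := inord k.-1.

Definition ep1 (j : 'I_27) : 'I_18 := vtx (nth (0,0) edges j).1.
Definition ep2 (j : 'I_27) : 'I_18 := vtx (nth (0,0) edges j).2.

Definition share (i j : 'I_27) : bool :=
  [|| ep1 i == ep1 j, ep1 i == ep2 j, ep2 i == ep1 j | ep2 i == ep2 j].

(* the nine hexagons (a,b,c,d,e,f), edge labels 1-based *)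
Definition hexagons : seq (seq nat) :=
  [:: [:: 2;4;6;1;13;22]; [:: 1;7;9;3;17;14]; [:: 3;10;5;2;23;18];
      [:: 11;15;19;8;4;5]; [:: 8;20;24;12;7;6]; [:: 12;25;16;11;10;9];
      [:: 26;13;14;21;15;16]; [:: 21;17;18;27;20;19]; [:: 27;23;22;26;25;24]].

Definition T0 : seq 'I_27 :=
  map edg [:: 5;6;8;9;11;12;14;16;18;19;20;21;22;24;25;26;27].

Definition hex_rel (G : agroup) (g : 'I_27 -> G) (h : seq nat) : Prop :=
  let U k := g (edg (nth 0 h k)) in
  U 0 ** U 1 ** U 2 ** U 3 ** U 4 = U 1 ** U 2 ** U 3 ** U 4 ** U 5.

Definition CRel (G : agroup) (g : 'I_27 -> G) : Prop :=
  [/\ (forall j, g j ** g j = gone),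
      (forall i j, ~~ share i j -> g i ** g j = g j ** g i),
      (forall i j, i != j -> share i j ->
                   g i ** g j ** g i = g j ** g i ** g j) &
      (forall h, h \in hexagons -> hex_rel g h)].

Definition presentsC (C : agroup) (u : 'I_27 -> C) : Prop :=
  CRel u /\
  forall (G : agroup) (g : 'I_27 -> G), CRel g ->
    exists! f : C -> G, ghom f /\ forall j, f (u j) = g j.

Definition HRel (G : agroup) (x y : 'I_18 -> G) (z : G) : Prop :=
  [/\ (forall i j, i != j ->
         [/\ gcomm (x i) (x j) = gone, gcomm (y i) (y j) = gone &
             gcomm (x i) (y j) = gone]),
      (forall i, gcomm (x i) (y i) = z) &
      central z].

Definition presentsH (H : agroup) (x y : 'I_18 -> H) (z : H) : Prop :=
  HRel x y z /\
  forall (G : agroup) (x' y' : 'I_18 -> G) (z' : G), HRel x' y' z' ->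
    exists! f : H -> G,
      [/\ ghom f, (forall i, f (x i) = x' i), (forall i, f (y i) = y' i) & f z = z'].

(* Main.v *)
(* The dual of the triangulation of the torus is the graph [T], which lifts to a planar
   hexagonal lattice, so each [u_j] should be a reflection given by its two endpoints
   [p], [q] and a displacement [(k, l)] in Z^2. In S_18 |x H this reflection is
   [srefl p q k l]. Conjugating the copy of S_18 by an element of H turns each
   transposition [(p q)] into the reflection whose displacement is the increment from
   [p] to [q] of a function on the vertices, a potential. Hence a relation between
   transpositions holds between reflections as soon as the displacements derive from
   a potential along the edges involved. This applies to each of (R1)-(R4), which gives a
   morphism from C to S_18 |x H, and to the spanning tree T_0.

   For its injectivity, the edges of a Hamiltonian path satisfy the Coxeter relations
   and yield a section rho : S_18 -> C. Conjugating [u_13] and [u_8] by rho produces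
   reflections [A p q] and [B p q] for all [p], [q], of displacements (1, 0) and
   (0, 1); these are well defined because a hexagon relation makes either generator
   commute with the transposition of the path neighbours of its endpoints.
   The translations [X p q = rho (p q) A p q] satisfy [X p q * X q r = X p r], and so do the
   [Y p q = rho (p q) B p q]; moreover [X p q] and [Y r s] commute when [p], [q],
   [r], [s] are distinct, so the commutator of [X p q] and [Y p s] depends only on [p].
   Seven hexagons express all the other generators but [u_15] through rho, A and B, and
   the last two give two expressions of [u_15], whose equality shows that this
   commutator does not depend on [p] either. It is therefore a central element Z, every
   element of C is a product rho(s) X^a Y^b Z^c where [a] and [b] have sum zero, and the
   model separates these products. *)

From HB Require Import structures.
Require Import Defs.
From mathcomp Require Import all_boot all_order all_algebra all_fingroup.
From mathcomp Require Import boolp ring zify.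
Set Implicit Arguments. Unset Strict Implicit. Unset Printing Implicit Defensive.
Import GRing.Theory Num.Theory.

Notation "{ 'gmorph' G -> H }" := (UMagmaMorphism.type G%type H%type)
  (at level 0, G at level 98, H at level 99, format "{ 'gmorph'  G  ->  H }") : type_scope.

(** * Groups *)

Section GroupMorphisms.
Local Open Scope group_scope.
Variables (G H : groupType) (f : G -> H).
Hypothesis fM : {morph f : x y / x * y}.

Lemma morph_mulg1 : f 1 = 1.
Proof. by apply: (mulgI (f 1)); rewrite -fM !mulg1. Qed.

Lemma group_monoid_morphism : monoid.monoid_morphism f.
Proof. by split; [apply: morph_mulg1 | apply: fM]. Qed.

Definition gmorph_of : {gmorph G -> H} :=
  HB.pack f (isUMagmaMorphism.Build G H f group_monoid_morphism).

End GroupMorphisms.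

Section ConjugatesAndCommutators.
Local Open Scope group_scope.
Variable G : groupType.
Implicit Types x y : G.

Lemma conjg_invol x y : y * y = 1 -> x ^ y = y * x * y.
Proof. by move=> yy; rewrite conjgE (mulg1_eq yy) mulgA. Qed.

Lemma conjg_braid x y : x * x = 1 -> y * y = 1 -> x * y * x = y * x * y -> y ^ x = x ^ y.
Proof. by move=> xx yy; rewrite !conjg_invol. Qed.

Lemma commMg_commute x y z : commute x z -> [~ x * y, z] = [~ y, z].
Proof.
move=> xz; apply: (mulgI (z * (x * y))); rewrite -commgC (mulgA z x) -xz.
by rewrite -(mulgA x z) -(mulgA x (z * y)) -commgC mulgA.
Qed.

Lemma commgM_commute x y z : commute x y -> [~ x, y * z] = [~ x, z].
Proof.
move=> xy; apply: (mulgI (y * z * x)); rewrite -commgC (mulgA x) xy.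
by rewrite -(mulgA y z) -(mulgA y (z * x)) -commgC mulgA.
Qed.

Lemma commuteR x y z : commute x y -> commute x z -> commute x [~ y, z].
Proof. by move=> xy xz; do ?apply: commuteM; rewrite //; apply: commuteV. Qed.

Lemma conjg_commgV x y : x ^ y = x * ([~ x, y^-1] ^ y)^-1.
Proof. by rewrite commgEl conjMg conjgKV invgM -conjVg invgK mulKVg. Qed.

Lemma commMg_central x y z : commute y [~ x, z] -> [~ x * y, z] = [~ x, z] * [~ y, z].
Proof.
move=> yxz; apply: (mulgI (z * (x * y))); rewrite -commgC.
have := commgC x z; have := commgC y z; move: [~ x, z] [~ y, z] yxz => c d yc yz xz.
by rewrite -mulgA yz !mulgA xz -(mulgA _ c y) -yc !mulgA.
Qed.

Lemma commVgV x y : commute x [~ x, y] -> commute y [~ x, y] -> [~ x^-1, y^-1] = [~ x, y].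
Proof.
move=> xz yz; apply: (mulIg (y * x)); rewrite -commgCV commgC.
by apply/commute_sym/commuteM; apply/commute_sym.
Qed.

Lemma mulgACJ x y z t : x * y * (z * t) = x * z * (y ^ z * t).
Proof. by rewrite -(mulgA x y) (mulgA y z) (conjgC y z) -(mulgA z) (mulgA x z). Qed.

Lemma commute_cancel x y z t : commute y z -> x * z * (y * t^-1) = x * y -> z = t.
Proof.
move=> yz; rewrite -mulgA => /mulgI; rewrite mulgA -yz -mulgA -[RHS]mulg1.
by move=> /mulgI/divg1_eq.
Qed.

End ConjugatesAndCommutators.

Section IntegerPowers.
Local Open Scope group_scope.
Variable G : groupType.
Implicit Types x y : G.

Definition expgz x (n : int) : G :=
  match n with Posz m => x ^+ m | Negz m => x ^- m.+1 end.

Lemma expgzS x n : expgz x (n + 1)%R = expgz x n * x.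
Proof.
case: n => [n|[|n]]; first by rewrite -PoszD addn1 [LHS]expgSr.
  by rewrite /= mulVg.
have -> : (Negz n.+1 + 1)%R = Negz n by lia.
by rewrite /= (expgS x n.+1) invgM mulgVK.
Qed.

Lemma expgzD x m n : expgz x (m + n)%R = expgz x m * expgz x n.
Proof.
have expgzB k : expgz x (k - 1)%R = expgz x k * x^-1.
  by apply: (mulIg x); rewrite -expgzS subrK mulgVK.
elim: n => [|n IHn|n IHn]; first by rewrite addr0 mulg1.
  by rewrite -addn1 PoszD addrA !expgzS IHn mulgA.
by rewrite -addn1 PoszD opprD addrA !expgzB IHn mulgA.
Qed.

Lemma expgz1 x : expgz x 1 = x.
Proof. by []. Qed.

Lemma expgzN x n : expgz x (- n)%R = (expgz x n)^-1.
Proof. by apply/esym/mulg1_eq; rewrite -expgzD subrr. Qed.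

Lemma commuteXz x y n : commute x y -> commute x (expgz y n).
Proof. by move=> xy; case: n => n; [|apply: commuteV]; apply: commuteX. Qed.

Lemma commuteXz2 x y m n : commute x y -> commute (expgz x m) (expgz y n).
Proof. by move=> xy; apply/commuteXz/commute_sym/commuteXz/commute_sym. Qed.

End IntegerPowers.

Lemma gmulfXz (G H : groupType) (f : {gmorph G -> H}) n : {morph f : x / expgz x n}.
Proof. by case: n => n x; [apply: gmulfXn | apply: gmulfXVn]. Qed.

Section Exponentials.
Local Open Scope group_scope.
Variable G : groupType.
Implicit Types (x : G).

Definition exponential (V : zmodType) (f : V -> G) : Prop :=
  {morph f : v w / (v + w)%R >-> v * w}.

Section OneExponential.
Variables (V : zmodType) (f : V -> G).
Hypothesis fD : exponential f.

Lemma exponential0 : f 0%R = 1.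
Proof. by apply: (mulgI (f 0%R)); rewrite -fD addr0 mulg1. Qed.

Lemma exponentialN v : f (- v)%R = (f v)^-1.
Proof. by apply/esym/mulg1_eq; rewrite -fD subrr exponential0. Qed.

Lemma exponentialMz v n : f (v *~ n)%R = expgz (f v) n.
Proof.
elim: n => [|n IHn|n IHn]; first by rewrite mulr0z exponential0.
  by rewrite -addn1 PoszD mulrzDr fD IHn expgzD.
by rewrite -addn1 PoszD opprD mulrzDr fD IHn expgzD mulrNz exponentialN.
Qed.

End OneExponential.

Lemma exponential_rV_ext n (f g : 'rV[int]_n -> G) : exponential f -> exponential g ->
  (forall i, f (delta_mx ord0 i) = g (delta_mx ord0 i)) -> f =1 g.
Proof.
move=> fD gD fg v; rewrite (row_sum_delta v).
elim/big_ind: _ => [|w w' e e'|i _]; first by rewrite !exponential0.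
  by rewrite fD gD e e'.
by rewrite -[v _ i]intz scaler_int !exponentialMz // fg.
Qed.

Lemma exponentialM (V : zmodType) (f g : V -> G) : (forall v w, commute (f v) (g w)) ->
  exponential f -> exponential g -> exponential (fun v => f v * g v).
Proof. by move=> fg fD gD v w; rewrite fD gD -mulgA (mulgA (f w)) (fg w v) !mulgA. Qed.

Lemma exponential_expgz (V : zmodType) (l : V -> int) x :
  {morph l : v w / (v + w)%R} -> exponential (fun v => expgz x (l v)).
Proof. by move=> lD v w; rewrite lD expgzD. Qed.

Definition prodz n (X : 'I_n -> G) (a : 'rV[int]_n) : G := \prod_i expgz (X i) (a ord0 i).

Lemma commute_prodz n (X : 'I_n -> G) a x :
  (forall i, commute x (X i)) -> commute x (prodz X a).
Proof. by move=> xX; apply: commute_prod => i _; apply: commuteXz. Qed.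

Lemma prodzD n (X : 'I_n -> G) : (forall i j, commute (X i) (X j)) -> exponential (prodz X).
Proof.
move=> XX a b; rewrite -prodgM_commute => [|i j _ _]; last exact/commuteXz2/XX.
by apply: eq_bigr => i _; rewrite mxE expgzD.
Qed.

Lemma prodz_delta n (X : 'I_n -> G) i : prodz X (delta_mx ord0 i) = X i.
Proof.
rewrite /prodz (@big_only1 _ _ _ _ i) => [|//|j /negPf ji _]; last by rewrite mxE ji.
by rewrite mxE !eqxx.
Qed.

End Exponentials.

Lemma gmulf_prodz (G H : groupType) (f : {gmorph G -> H}) n (X : 'I_n -> G) a :
  f (prodz X a) = prodz (f \o X) a.
Proof. by rewrite gmulf_prod; apply: eq_bigr => i _; rewrite gmulfXz. Qed.

(** * Normal forms in groups with central commutators *)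

Section HeisenbergFamilies.
Local Open Scope group_scope.
Variables (G : groupType) (n : nat).
Implicit Types (W : 'I_n -> G) (a b : 'rV[int]_n) (c : int).

Lemma commg_prodz_central W (Z x : G) (l : 'rV[int]_n -> int) :
  (forall i j, commute (W i) (W j)) -> (forall i, commute Z (W i)) ->
  {morph l : v w / (v + w)%R} ->
  (forall i, [~ W i, x] = expgz Z (l (delta_mx ord0 i))) ->
  forall a, [~ prodz W a, x] = expgz Z (l a).
Proof.
move=> WW ZW lD Wx a; rewrite commgEl; apply: (canLR (mulKg _)); move: a.
apply: exponential_rV_ext => [a b||i]; first by rewrite (prodzD WW) conjMg.
  apply: (exponentialM _ (prodzD WW) (exponential_expgz Z lD)) => a b.
  by apply/commuteXz/commute_sym/commute_prodz.
by rewrite !prodz_delta -Wx commgEl mulVKg.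
Qed.

Variables (X Y : 'I_n -> G) (Z : G) (form : 'rV[int]_n -> 'rV[int]_n -> int).
Hypothesis XX : forall i j, commute (X i) (X j).
Hypothesis YY : forall i j, commute (Y i) (Y j).
Hypothesis ZX : forall i, commute Z (X i).
Hypothesis ZY : forall i, commute Z (Y i).
Hypothesis formDl : forall b, {morph form^~ b : a a' / (a + a')%R}.
Hypothesis formDr : forall a, {morph form a : b b' / (b + b')%R}.
Hypothesis XY : forall i j,
  [~ X i, Y j] = expgz Z (form (delta_mx ord0 i) (delta_mx ord0 j)).

Lemma commg_prodz a b : [~ prodz X a, prodz Y b] = expgz Z (form a b).
Proof.
apply: (commg_prodz_central (l := form^~ b)) => // i.
rewrite -invgR; apply: (canLR invgK); rewrite -expgzN.
apply: (commg_prodz_central (l := fun b => (- form (delta_mx ord0 i) b)%R)) => // [v w|j].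
  by rewrite formDr opprD.
by rewrite expgzN -XY invgR.
Qed.

Definition heis_word a b c : G := prodz X a * prodz Y b * expgz Z c.

Lemma heis_wordM a b c a' b' c' :
  heis_word a b c * heis_word a' b' c'
  = heis_word (a + a')%R (b + b')%R (c + c' - form a' b)%R.
Proof.
have commuteZ W k v : (forall i, commute Z (W i)) -> commute (expgz Z k) (prodz W v).
  by move=> ZW; apply: commute_prodz => i; apply/commute_sym/commuteXz/commute_sym.
have YX : prodz Y b * prodz X a' = prodz X a' * prodz Y b * expgz Z (- form a' b)%R.
  by rewrite commgC -invgR commg_prodz expgzN.
rewrite /heis_word (prodzD XX) (prodzD YY) [(_ - form _ _)%R]addrC !expgzD.
rewrite -!mulgA (mulgA (expgz Z c)) (commuteZ X c a' ZX).
rewrite -!mulgA (mulgA (expgz Z c)) (commuteZ Y c b' ZY).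
rewrite -!mulgA (mulgA (prodz Y b)) YX -!mulgA (mulgA _ (prodz Y b')).
by rewrite (commuteZ Y _ b' ZY) -!mulgA.
Qed.

End HeisenbergFamilies.

Lemma eq_heis_word (G : groupType) n (X X' Y Y' : 'I_n -> G) Z a b c :
  X =1 X' -> Y =1 Y' -> heis_word X Y Z a b c = heis_word X' Y' Z a b c.
Proof.
by move=> XX' YY'; congr (_ * _ * _)%g; apply: eq_bigr => i _; rewrite ?XX' ?YY'.
Qed.

Lemma gmulf_heis_word (G H : groupType) (f : {gmorph G -> H}) n (X Y : 'I_n -> G) Z a b c :
  f (heis_word X Y Z a b c) = heis_word (f \o X) (f \o Y) (f Z) a b c.
Proof. by rewrite /heis_word !gmulfM !gmulf_prodz gmulfXz. Qed.

(** * Subgroups and transpositions *)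

Section Subgroups.
Local Open Scope group_scope.
Variable G : groupType.

Definition subgroup (P : G -> Prop) : Prop :=
  [/\ P 1, forall x y, P x -> P y -> P (x * y) & forall x, P x -> P x^-1].

Lemma subgroupJ P x y : subgroup P -> P x -> P y -> P (x ^ y).
Proof. by case=> _ PM PV Px Py; exact: (PM _ _ (PV _ Py) (PM _ _ Px Py)). Qed.

Lemma subgroupXz P x n : subgroup P -> P x -> P (expgz x n).
Proof.
case=> P1 PM PV Px; have PX m : P (x ^+ m).
  by elim: m => // m; rewrite expgS; apply: PM.
by case: n => n; [|apply: PV]; apply: PX.
Qed.

Lemma subgroup_commute x : subgroup (commute x).
Proof. by split; [apply: commute1 | apply: commuteM | apply: commuteV]. Qed.

End Subgroups.

Lemma subgroup_preim (G H : groupType) (f : {gmorph G -> H}) (P : H -> Prop) :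
  subgroup P -> subgroup (P \o f).
Proof.
case=> P1 PM PV; split=> [|x y|x] /=; first by rewrite gmulf1.
  by rewrite gmulfM; apply: PM.
by rewrite gmulfV; apply: PV.
Qed.

(* Solves disequalities, and conjunctions of them such as [uniq [:: p; q; r]], from
   others in the context. *)
Ltac distinct :=
  rewrite /= ?inE ?negb_or; repeat (apply/andP; split); try done;
  apply/eqP => ?; subst;
  repeat match goal with
  | h : is_true (uniq _) |- _ => move: h
  | h : is_true (_ \notin _) |- _ => move: h
  | h : is_true (~~ (_ == _)) |- _ => move: h
  end;
  rewrite /= ?inE ?eqxx /= ?orbT /= ?andbF; done.

Section Transpositions.
Local Open Scope group_scope.
Variable T : finType.
Implicit Types (A : {set T}) (s : {perm T}) (p q r : T).

Lemma tperm_braid p q r : p != q -> q != r -> p != r ->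
  tperm p q * tperm q r * tperm p q = tperm p r.
Proof.
move=> pq qr pr; rewrite -mulgA -{1}[tperm p q]tpermV -conjgE tpermJ tpermR.
by rewrite tpermD.
Qed.

Lemma perm_map_exists (s t : seq T) : uniq s -> uniq t -> size s = size t ->
  exists f : {perm T}, map f s = t.
Proof.
elim: s t => [|a s IHs] [|b t] //=; first by exists 1.
case/andP=> as_ us /andP[bt ut] [/(IHs _ us ut) [f ft]].
exists (f * tperm (f a) b); rewrite permM tpermL; congr (_ :: _).
rewrite -[RHS]ft; apply/eq_in_map => x xs; rewrite permM tpermD //.
  by rewrite (inj_eq perm_inj); apply: contraNneq as_ => ->.
by apply: contraNneq bt => ->; rewrite -ft map_f.
Qed.

Lemma exists_notin (s : seq T) : size s < #|T| -> exists x, x \notin s.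
Proof.
rewrite ltnNge => sT; apply/existsP; apply: contraNT sT => /existsPn s_full.
apply: leq_trans (card_size s); apply/subset_leq_card/subsetP => x _.
exact/negbNE/s_full.
Qed.

Lemma perm_on_ind A (P : {perm T} -> Prop) : P 1 ->
  (forall s x y, P s -> x \in A -> y \in A -> P (s * tperm x y)) ->
  forall s, perm_on A s -> P s.
Proof.
move=> P1 PM s; have [m] := ubnP #|[set x | s x != x]|.
elim: m s => // m IHm s; rewrite ltnS => sm sA.
have [x /= sx|s1] := pickP [pred x | s x != x]; last first.
  rewrite (_ : s = 1) //; apply/permP => x; rewrite perm1.
  by have /negbFE/eqP := s1 x.
have xA : x \in A := subsetP sA _ sx.
have sxA : s x \in A by rewrite perm_closed.
rewrite -(mulgK (tperm x (s x)) s) tpermV; apply: (PM) => //; apply: IHm; last first.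
  apply: perm_onM => //; apply: subset_trans (tperm_on _ _) _.
  by apply/subsetP => y; rewrite !inE => /orP[] /eqP ->.
apply: leq_trans sm; apply: proper_card; apply/properP; split; last first.
  by exists x; rewrite !inE ?permM ?tpermR ?eqxx.
apply/subsetP => y; rewrite !inE permM; apply: contraNneq => sy; rewrite sy.
have xy : x != y by apply: contraNneq sx => ->; rewrite sy.
by rewrite tpermD // -sy (inj_eq perm_inj).
Qed.

Section GeneratedByTranspositions.
Variable P : {perm T} -> Prop.
Hypothesis P_subgroup : subgroup P.

Lemma subgroup_tperm_trans q p r : P (tperm p q) -> P (tperm q r) -> P (tperm p r).
Proof.
have [->//|pq] := eqVneq p q; have [->//|qr] := eqVneq q r.
have [->|pr] := eqVneq p r; first by rewrite tperm1; case: P_subgroup.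
move=> Ppq Pqr; rewrite -(tperm_braid pq qr pr); case: P_subgroup => _ PM _.
exact: PM (PM _ _ Ppq Pqr) Ppq.
Qed.

Lemma subgroup_perm_on A r : (forall x, x \in A -> P (tperm r x)) ->
  forall s, perm_on A s -> P s.
Proof.
move=> Pr; case: (P_subgroup) => P1 PM _; apply: perm_on_ind => // s x y Ps xA yA.
by apply: (PM) => //; apply: (@subgroup_tperm_trans r); [rewrite tpermC|]; apply: Pr.
Qed.

End GeneratedByTranspositions.
End Transpositions.

(* [grows seen es]: the edges [es], oriented, can be added one by one to a tree
   that already spans [seen]. *)
Fixpoint grows (V : eqType) (seen : seq V) (es : seq (V * V)) : bool :=
  if es is e :: es' then (e.1 \in seen) && grows (e.2 :: seen) es' else true.

Lemma subgroup_tree (T : finType) (V : eqType) (f : V -> T) (P : {perm T} -> Prop) r es :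
  subgroup P -> grows [:: r] es -> {in es, forall e, P (tperm (f e.1) (f e.2))} ->
  {in r :: map snd es, forall v, P (tperm (f r) (f v))}.
Proof.
move=> subP; have : {in [:: r], forall v, P (tperm (f r) (f v))}.
  by move=> v /[!inE] /eqP ->; rewrite tperm1; case: subP.
rewrite -[r :: map _ _]cat1s; elim: es [:: r] => [|e es IHes] seen Pseen; first by rewrite cats0.
move=> /= /andP[e1 gr] Pes; have Pe : P (tperm (f r) (f e.2)).
  by apply: (subgroup_tperm_trans subP) (Pseen _ e1) _; apply: Pes (mem_head _ _).
move=> v; rewrite mem_cat inE orbCA orbA -in_cons -mem_cat.
apply: (IHes (e.2 :: seen)) => // [w|e' e'es]; last by apply: Pes; rewrite inE e'es orbT.
by rewrite inE => /predU1P[->|/Pseen].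
Qed.

(** * The Coxeter presentation of the symmetric group *)

Section Descents.
Local Open Scope group_scope.
Variable G : groupType.

Definition coxeter (n : nat) (t : nat -> G) : Prop :=
  [/\ forall i, i < n -> t i * t i = 1,
      forall i j, i.+1 < j -> j < n -> commute (t i) (t j) &
      forall i, i.+1 < n -> t i * t i.+1 * t i = t i.+1 * t i * t i.+1].

Fixpoint descent (t : nat -> G) (m d : nat) : G :=
  if d is d'.+1 then t (m + d') * descent t m d' else 1.

Lemma descentSr t m d : descent t m d.+1 = descent t m.+1 d * t m.
Proof.
elim: d => [|d IHd]; first by rewrite /= addn0 mul1g mulg1.
by rewrite [LHS]/= -/(descent t m d.+1) IHd mulgA addnS.
Qed.

Variables (n : nat) (t : nat -> G).
Hypothesis t_coxeter : coxeter n t.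

Lemma commute_descent_lt m d i : i.+1 < m -> m + d <= n -> commute (t i) (descent t m d).
Proof.
move=> im; elim: d => [|d IHd] md; first exact: commute1.
by case: t_coxeter => _ tt _; apply: commuteM; [apply: tt; lia | apply: IHd; lia].
Qed.

Lemma commute_descent_gt m d i : m + d < i -> i < n -> commute (t i) (descent t m d).
Proof.
move=> im i_n; elim: d im => [|d IHd] md; first exact: commute1.
case: t_coxeter => _ tt _; apply: commuteM; last by apply: IHd; lia.
by apply/commute_sym/tt; lia.
Qed.

Lemma descentMt m d i : m < i -> i < m + d -> m + d <= n ->
  descent t m d * t i = t i.-1 * descent t m d.
Proof.
case: t_coxeter => _ tt br mi; elim: d => [|d IHd] imd mdn; first lia.
have [im|im] := ltnP i (m + d).
  rewrite [descent _ _ _]/= -mulgA IHd //; last lia.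
  by rewrite !mulgA; congr (_ * _); apply/commute_sym/tt; lia.
have {im}ei : i = m + d by lia.
case: d imd mdn ei {IHd} => [|d] imd mdn ei; first lia.
rewrite /= addnS in ei *; rewrite -!mulgA -(@commute_descent_gt m d i); [|lia|lia].
by rewrite ei !mulgA /=; congr (_ * _); rewrite -br //; lia.
Qed.

End Descents.

Section SymmetricGroup.
Local Open Scope group_scope.
Variable n : nat.
Implicit Types s : {perm 'I_n.+1}.

Definition adjt (i : nat) : {perm 'I_n.+1} := tperm (inord i) (inord i.+1).

Lemma inord_eq i j : i < n.+1 -> j < n.+1 -> (inord i == inord j :> 'I_n.+1) = (i == j).
Proof. by move=> i_n j_n; rewrite -val_eqE /= !inordK. Qed.

Lemma adjt_coxeter : coxeter n adjt.
Proof.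
split=> [i _|i j ij j_n|i i_n]; first exact: tperm2.
  by apply/commgP/conjg_fixP; rewrite tpermJ !tpermD // inord_eq //; lia.
rewrite /adjt tperm_braid ?inord_eq //; try lia.
rewrite ![tperm (inord i) _]tpermC [tperm (inord i.+1) _]tpermC.
by rewrite tperm_braid ?inord_eq //; lia.
Qed.

Lemma adjtD i j : i < n -> j < n.+1 -> j != i -> j != i.+1 -> adjt i (inord j) = inord j.
Proof. by move=> *; rewrite tpermD ?inord_eq // 1?eq_sym //; lia. Qed.

Lemma descent_adjtD m d j : m + d < j -> j < n.+1 -> descent adjt m d (inord j) = inord j.
Proof.
elim: d => [|d IHd] jm j_n; first by rewrite /= perm1.
by rewrite permM adjtD; try lia; apply: IHd; lia.
Qed.

Lemma descent_adjtR m d : m + d < n.+1 -> descent adjt m d (inord (m + d)) = inord m.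
Proof.
elim: d => [|d IHd] md; first by rewrite addn0 /= perm1.
by rewrite permM addnS tpermR IHd //; lia.
Qed.

Definition fixes_from k s := forall j, k <= j -> j < n.+1 -> s (inord j) = inord j.

Lemma fixes_from_leq k s : k < n.+1 -> fixes_from k.+1 s -> s (inord k) <= k.
Proof.
move=> k_n sk; rewrite leqNgt; apply/negP => ks.
have := sk _ ks (ltn_ord _); rewrite inord_val => /perm_inj e.
by move: ks; rewrite e inordK ?ltnn.
Qed.

Definition top_descent k s : {perm 'I_n.+1} :=
  descent adjt (s (inord k)) (k - s (inord k)).

Lemma fixes_from_top_descent k s : k < n.+1 -> fixes_from k.+1 s ->
  fixes_from k (s * (top_descent k s)^-1).
Proof.
move=> k_n sk j kj j_n; have sb := fixes_from_leq k_n sk.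
rewrite permM; apply: (canLR (permK _)).
have [->|jk] : j = k \/ k < j by lia.
  have := @descent_adjtR (s (inord k)) (k - s (inord k)).
  by rewrite subnKC // inord_val => ->.
by rewrite sk // descent_adjtD //; lia.
Qed.

Lemma adjt_ind (P : {perm 'I_n.+1} -> Prop) : P 1 ->
  (forall s i, i < n -> P s -> P (s * adjt i)) -> forall s, P s.
Proof.
move=> P1 PM; have Pdescent s m d : m + d < n.+1 -> P s -> P (s * descent adjt m d).
  elim: d m => [|d IHd] m md Ps; first by rewrite mulg1.
  by rewrite descentSr mulgA; apply: PM; [lia | apply: IHd; [lia |]].
suff Pk k s : k <= n.+1 -> fixes_from k s -> P s by move=> s; apply: (@Pk n.+1) => // j; lia.
elim: k s => [|k IHk] s k_n sk.
  rewrite (_ : s = 1) //; apply/permP => j.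
  by have := sk j; rewrite inord_val perm1; apply.
rewrite -(mulgVK (top_descent k s) s); apply: Pdescent.
  by rewrite subnKC //; apply: fixes_from_leq.
by apply: IHk; [lia | apply: fixes_from_top_descent].
Qed.

Section CoxeterMorphism.
Variables (G : groupType) (t : nat -> G).
Hypothesis t_coxeter : coxeter n t.

Fixpoint cox_word (k : nat) s : G :=
  if k is k'.+1 then
    cox_word k' (s * (top_descent k' s)^-1) * descent t (s (inord k')) (k' - s (inord k'))
  else 1.

Lemma cox_word1 k : k <= n.+1 -> cox_word k 1 = 1.
Proof.
elim: k => //= k IHk k_n; rewrite /top_descent !perm1 inordK // subnn.
by rewrite mulg1 mulgV IHk // ltnW.
Qed.

Lemma cox_word_adjt k s i : k <= n.+1 -> fixes_from k s -> i.+1 < k ->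
  cox_word k (s * adjt i) = cox_word k s * t i.
Proof.
elim: k s i => // k IHk s i k_n sk ik.
have mk := fixes_from_leq k_n sk; have sk' := fixes_from_top_descent k_n sk.
rewrite /= /top_descent permM; rewrite /top_descent in sk'.
set m := s (inord k) in mk sk' *; have em : m = inord m by rewrite inord_val.
have i_n : i < n by lia.
have [im|[im|[im|im]]] : i.+1 < m \/ i.+1 = m \/ i = m \/ m < i by lia.
- have -> : adjt i m = m by rewrite em adjtD //; lia.
  have c := commute_descent_lt adjt_coxeter im (_ : m + (k - m) <= n).
  have c' := commute_descent_lt t_coxeter im (_ : m + (k - m) <= n).
  rewrite -mulgA (commuteV (c _)); last lia.
  by rewrite mulgA IHk //; [rewrite -!mulgA c' //; lia | lia | lia].
- have -> : adjt i m = inord i by rewrite em -im /adjt tpermR.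
  rewrite inordK; last lia.
  have -> : k - i = (k - m).+1 by lia.
  by rewrite !descentSr im invgM -!mulgA (mulgA (adjt i)) mulgV mul1g !mulgA.
- have -> : adjt i m = inord i.+1 by rewrite em im /adjt tpermL.
  rewrite inordK; last lia.
  have -> : k - m = (k - i.+1).+1 by lia.
  rewrite -im !descentSr invgM; case: (t_coxeter) => sq _ _.
  by rewrite -!mulgA sq // mulg1 tpermV.
- have -> : adjt i m = m by rewrite em adjtD //; lia.
  have c := descentMt adjt_coxeter im (_ : i < m + (k - m)) (_ : m + (k - m) <= n).
  have c' := descentMt t_coxeter im (_ : i < m + (k - m)) (_ : m + (k - m) <= n).
  rewrite -!mulgA c'; [|lia|lia].
  have -> : adjt i * (descent adjt m (k - m))^-1 = (descent adjt m (k - m))^-1 * adjt i.-1.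
    by apply: (mulgI (descent adjt m (k - m))); rewrite mulgA c ?mulgK ?mulKVg //; lia.
  by rewrite mulgA IHk //; [rewrite -!mulgA | lia | lia].
Qed.

Lemma coxeter_morphism : exists f : {gmorph {perm 'I_n.+1} -> G},
  forall i, i < n -> f (adjt i) = t i.
Proof.
have wordS s i : i < n -> cox_word n.+1 (s * adjt i) = cox_word n.+1 s * t i.
  by move=> i_n; apply: cox_word_adjt => // j; lia.
have fM : {morph cox_word n.+1 : s s' / s * s'}.
  move=> s s'; elim/adjt_ind: s' => [|s' i i_n IHs]; first by rewrite cox_word1 // !mulg1.
  by rewrite mulgA !wordS // IHs -mulgA.
by exists (gmorph_of fM) => i i_n; have := wordS 1 i i_n; rewrite mul1g cox_word1 // mul1g.
Qed.

End CoxeterMorphism.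
End SymmetricGroup.

(** * The Heisenberg group and its semidirect product with permutations *)

Section DotProduct.
Local Open Scope ring_scope.
Variables (R : comNzRingType) (n : nat).
Implicit Types (a b : 'rV[R]_n) (s : {perm 'I_n}) (p q : 'I_n).

Definition dot a b : R := (a *m b^T) 0 0.

Lemma dotDl b : {morph dot^~ b : a a' / a + a'}.
Proof. by move=> a a'; rewrite /dot mulmxDl mxE. Qed.

Lemma dotDr a : {morph dot a : b b' / b + b'}.
Proof. by move=> b b'; rewrite /dot linearD mulmxDr mxE. Qed.

Lemma dotZl k a b : dot (k *: a) b = k * dot a b.
Proof. by rewrite /dot -scalemxAl mxE. Qed.

Lemma dotZr k a b : dot a (k *: b) = k * dot a b.
Proof. by rewrite /dot linearZ /= -scalemxAr mxE. Qed.

Lemma dotNl a b : dot (- a) b = - dot a b.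
Proof. by rewrite -scaleN1r dotZl mulN1r. Qed.

Lemma dotNr a b : dot a (- b) = - dot a b.
Proof. by rewrite -scaleN1r dotZr mulN1r. Qed.

Lemma dot0l b : dot 0 b = 0.
Proof. by rewrite /dot mul0mx mxE. Qed.

Lemma dot0r a : dot a 0 = 0.
Proof. by rewrite /dot linear0 mulmx0 mxE. Qed.

Lemma dot_deltal a p : dot (delta_mx 0 p) a = a 0 p.
Proof. by rewrite /dot -rowE !mxE. Qed.

Lemma dot_deltar a p : dot a (delta_mx 0 p) = a 0 p.
Proof. by rewrite /dot trmx_delta -colE mxE. Qed.

Lemma dot_perm s a b : dot (a *m perm_mx s) (b *m perm_mx s) = dot a b.
Proof.
rewrite /dot trmx_mul -mulmxA (mulmxA (perm_mx s)) tr_perm_mx -perm_mxM mulgV.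
by rewrite perm_mx1 mul1mx.
Qed.

Lemma delta_perm s p : delta_mx 0 p *m perm_mx s = delta_mx 0 (s p) :> 'rV[R]_n.
Proof. by rewrite -rowE; apply/rowP => j; rewrite !mxE eqxx eq_sym. Qed.

Definition dvec p q : 'rV[R]_n := delta_mx 0 q - delta_mx 0 p.

Lemma dvecC p q : dvec q p = - dvec p q.
Proof. by rewrite opprB. Qed.

Lemma dvec_id p : dvec p p = 0.
Proof. exact: subrr. Qed.

Lemma dvec_perm s p q : dvec p q *m perm_mx s = dvec (s p) (s q).
Proof. by rewrite mulmxBl !delta_perm. Qed.

Lemma dot_dvecl a p q : dot (dvec p q) a = a 0 q - a 0 p.
Proof. by rewrite dotDl dotNl !dot_deltal. Qed.

Lemma row_mul_tperm a p q : a *m perm_mx (tperm p q) = a - (a 0 q - a 0 p) *: dvec p q.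
Proof.
have -> : a *m perm_mx (tperm p q) = col_perm (tperm p q) a by rewrite col_permE tpermV.
apply/rowP=> k; rewrite !mxE; case: (tpermP p q k) => [->|->|/eqP kp /eqP kq].
- by rewrite !eqxx; case: eqVneq => [->|_] /=; ring.
- by rewrite !eqxx; case: eqVneq => [->|_] /=; ring.
- by rewrite (negPf kp) (negPf kq) /=; ring.
Qed.

End DotProduct.

Section Heisenberg.
Local Open Scope ring_scope.
Variables (R : comNzRingType) (n : nat).

Record heis := Heis { hx : 'rV[R]_n; hy : 'rV[R]_n; hz : R }.

Definition heis_pair h := (hx h, hy h, hz h).
Definition pair_heis u := Heis u.1.1 u.1.2 u.2.

Lemma heis_pairK : cancel heis_pair pair_heis. Proof. by case. Qed.

HB.instance Definition _ := Choice.copy heis (can_type heis_pairK).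

Implicit Types (g h : heis) (s t : {perm 'I_n}).

Lemma heis_eq g h : hx g = hx h -> hy g = hy h -> hz g = hz h -> g = h.
Proof. by case: g h => [a b c] [a' b' c'] /= -> -> ->. Qed.

Definition heis_mul g h := Heis (hx g + hx h) (hy g + hy h) (hz g + hz h - dot (hx h) (hy g)).
Definition heis_one := Heis 0 0 0.
Definition heis_inv h := Heis (- hx h) (- hy h) (- hz h - dot (hx h) (hy h)).

Lemma heis_mulA : associative heis_mul.
Proof. by move=> f g h; apply: heis_eq; rewrite /= ?addrA // dotDl dotDr; ring. Qed.

Lemma heis_mul1g : left_id heis_one heis_mul.
Proof. by move=> h; apply: heis_eq; rewrite /= ?dot0r ?subr0 add0r. Qed.

Lemma heis_mulg1 : right_id heis_one heis_mul.
Proof. by move=> h; apply: heis_eq; rewrite /= ?dot0l ?subr0 addr0. Qed.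

Lemma heis_mulVg : left_inverse heis_one heis_inv heis_mul.
Proof. by move=> h; apply: heis_eq; rewrite /= ?addNr // dotNr; ring. Qed.

Lemma heis_mulgV : right_inverse heis_one heis_inv heis_mul.
Proof. by move=> h; apply: heis_eq; rewrite /= ?subrr // dotNl; ring. Qed.

HB.instance Definition _ :=
  isGroup.Build heis heis_mulA heis_mul1g heis_mulg1 heis_mulVg heis_mulgV.

Lemma heisM a b c a' b' c' :
  (Heis a b c * Heis a' b' c')%g = Heis (a + a') (b + b') (c + c' - dot a' b).
Proof. by []. Qed.

Definition heis_perm s h := Heis (hx h *m perm_mx s) (hy h *m perm_mx s) (hz h).

Lemma heis_perm_mul s : {morph heis_perm s : g h / (g * h)%g}.
Proof. by move=> g h; apply: heis_eq; rewrite /= ?mulmxDl ?dot_perm. Qed.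

HB.instance Definition _ s :=
  isUMagmaMorphism.Build heis heis (heis_perm s) (group_monoid_morphism (heis_perm_mul s)).

Lemma heis_perm1 h : heis_perm 1%g h = h.
Proof. by apply: heis_eq; rewrite /= ?perm_mx1 ?mulmx1. Qed.

Lemma heis_permM s t h : heis_perm (s * t)%g h = heis_perm t (heis_perm s h).
Proof. by apply: heis_eq; rewrite //= perm_mxM mulmxA. Qed.

Lemma exponential_heis_x : exponential (fun a => Heis a 0 0).
Proof. by move=> a b; rewrite heisM dot0r subr0 !addr0. Qed.

Lemma exponential_heis_y : exponential (fun b => Heis 0 b 0).
Proof. by move=> a b; rewrite heisM dot0l subr0 !addr0. Qed.

Lemma exponential_heis_z : exponential (fun c => Heis 0 0 c).
Proof. by move=> a b; rewrite heisM dot0l subr0 !addr0. Qed.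

Lemma heis_xyz a b c : (Heis a 0 0 * Heis 0 b 0 * Heis 0 0 c)%g = Heis a b c.
Proof. by rewrite !heisM !dot0l !subr0 !addr0 !add0r. Qed.

Record sheis := SHeis { sh_perm : {perm 'I_n}; sh_heis : heis }.

Definition sheis_pair m := (sh_perm m, sh_heis m).
Definition pair_sheis u := SHeis u.1 u.2.

Lemma sheis_pairK : cancel sheis_pair pair_sheis. Proof. by case. Qed.

HB.instance Definition _ := Choice.copy sheis (can_type sheis_pairK).

Implicit Types m : sheis.

Lemma sheis_eq m m' : sh_perm m = sh_perm m' -> sh_heis m = sh_heis m' -> m = m'.
Proof. by case: m m' => [s h] [s' h'] /= -> ->. Qed.

Definition sheis_mul m m' :=
  SHeis (sh_perm m * sh_perm m')%g
    (heis_perm (sh_perm m') (sh_heis m) * sh_heis m')%g.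
Definition sheis_one := SHeis 1%g 1%g.
Definition sheis_inv m :=
  SHeis (sh_perm m)^-1%g (heis_perm (sh_perm m)^-1%g (sh_heis m))^-1%g.

Lemma sheis_mulA : associative sheis_mul.
Proof.
move=> m1 m2 m3; apply: sheis_eq; first exact: mulgA.
by rewrite /= heis_perm_mul heis_permM mulgA.
Qed.

Lemma sheis_mul1g : left_id sheis_one sheis_mul.
Proof. by move=> m; apply: sheis_eq; rewrite /= ?gmulf1 mul1g. Qed.

Lemma sheis_mulg1 : right_id sheis_one sheis_mul.
Proof. by move=> m; apply: sheis_eq; rewrite /= ?heis_perm1 mulg1. Qed.

Lemma sheis_mulVg : left_inverse sheis_one sheis_inv sheis_mul.
Proof.
move=> m; apply: sheis_eq; rewrite /= ?mulVg //.
rewrite /= gmulfV /= -heis_permM mulVg heis_perm1.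
exact: mulVg.
Qed.

Lemma sheis_mulgV : right_inverse sheis_one sheis_inv sheis_mul.
Proof. by move=> m; apply: sheis_eq; rewrite /= mulgV. Qed.

HB.instance Definition _ :=
  isGroup.Build sheis sheis_mulA sheis_mul1g sheis_mulg1 sheis_mulVg sheis_mulgV.

Lemma sheisM s h s' h' :
  (SHeis s h * SHeis s' h')%g = SHeis (s * s')%g (heis_perm s' h * h')%g.
Proof. by []. Qed.

Lemma sh_permM : {morph sh_perm : m m' / (m * m')%g}.
Proof. by []. Qed.

Definition sh_lift s := SHeis s 1%g.

Lemma sh_liftM : {morph sh_lift : s t / (s * t)%g}.
Proof. by move=> s t; rewrite sheisM gmulf1 mul1g. Qed.

Definition sh_incl h := SHeis 1%g h.

Lemma sh_inclM : {morph sh_incl : g h / (g * h)%g}.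
Proof. by move=> g h; rewrite sheisM mulg1 heis_perm1. Qed.

HB.instance Definition _ :=
  isUMagmaMorphism.Build sheis {perm 'I_n} sh_perm (group_monoid_morphism sh_permM).
HB.instance Definition _ :=
  isUMagmaMorphism.Build {perm 'I_n} sheis sh_lift (group_monoid_morphism sh_liftM).
HB.instance Definition _ :=
  isUMagmaMorphism.Build heis sheis sh_incl (group_monoid_morphism sh_inclM).

Lemma sh_lift_incl s h : (sh_lift s * sh_incl h)%g = SHeis s h.
Proof. by rewrite sheisM mulg1 heis_perm1 mul1g. Qed.

Lemma sh_incl_lift h s : (sh_incl h * sh_lift s)%g = SHeis s (heis_perm s h).
Proof. by rewrite sheisM mul1g mulg1. Qed.

Lemma sh_inclJ h s : (sh_incl h ^ sh_lift s)%g = sh_incl (heis_perm s h).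
Proof. by apply: (mulgI (sh_lift s)); rewrite -conjgC sh_incl_lift sh_lift_incl. Qed.

End Heisenberg.

Section HeisenbergCommutators.
Local Open Scope ring_scope.
Variables (R : comNzRingType) (n : nat).
Implicit Types (g h : heis R n).

Lemma heis_commg g h :
  [~ g, h]%g = Heis 0 0 (dot (hx g) (hy h) - dot (hx h) (hy g)).
Proof.
apply: (mulgI (h * g)%g); rewrite -commgC; apply: heis_eq; rewrite /= ?addr0 1?addrC //.
by rewrite !dot0l; ring.
Qed.

Lemma commute_heis_z g c : commute g (Heis 0 0 c).
Proof. by apply/commgP/eqP; rewrite heis_commg /= dot0l dot0r subrr. Qed.

Lemma commute_sheis_z (m : sheis R n) c : commute m (sh_incl (Heis 0 0 c)).
Proof.
case: m => s h; rewrite -sh_lift_incl; apply/commute_sym/commuteM.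
  by apply/commgP/conjg_fixP; rewrite sh_inclJ /heis_perm /= !mul0mx.
by rewrite /commute -!sh_inclM commute_heis_z.
Qed.

End HeisenbergCommutators.

Section Reflections.
Local Open Scope ring_scope.
Variables (R : comNzRingType) (n : nat).
Implicit Types (p q r : 'I_n) (phi chi : 'I_n -> R) (s : {perm 'I_n}).

(* The central coordinate is forced: it is the only one for which the element squares to 1. *)
Definition srefl p q (k l : R) : sheis R n :=
  SHeis (tperm p q) (Heis (k *: dvec R p q) (l *: dvec R p q) (- (k * l))).

Lemma sreflC p q k l : srefl p q k l = srefl q p (- k) (- l).
Proof. by rewrite /srefl (tpermC q p) (dvecC R p q) !scalerN !scaleNr mulrNN !opprK. Qed.

Lemma srefl0 p q : srefl p q 0 0 = sh_lift R (tperm p q).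
Proof. by rewrite /srefl !scale0r mul0r oppr0. Qed.

Lemma sreflJ p q k l s : (srefl p q k l ^ sh_lift R s)%g = srefl (s p) (s q) k l.
Proof.
rewrite /srefl -!sh_lift_incl conjMg -gmulfJ tpermJ sh_inclJ; congr (_ * sh_incl _)%g.
by rewrite /heis_perm /= -!scalemxAl !dvec_perm.
Qed.

Definition gauge phi chi s : sheis R n :=
  (sh_lift R s ^ sh_incl (Heis (\row_i phi i) (\row_i chi i) 0))%g.

Lemma gaugeM phi chi : {morph gauge phi chi : s t / (s * t)%g}.
Proof. by move=> s t; rewrite /gauge sh_liftM conjMg. Qed.

HB.instance Definition _ phi chi :=
  isUMagmaMorphism.Build {perm 'I_n} (sheis R n) (gauge phi chi)
    (group_monoid_morphism (gaugeM phi chi)).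

Lemma gauge_tperm phi chi p q :
  gauge phi chi (tperm p q) = srefl p q (phi q - phi p) (chi q - chi p).
Proof.
rewrite /gauge; set h := Heis _ _ _; apply: (mulgI (sh_incl h)); rewrite -conjgC.
rewrite sh_lift_incl [RHS]sheisM mul1g; congr SHeis.
rewrite /heis_perm /h /= !row_mul_tperm heisM !mxE !subrK; congr Heis.
rewrite add0r dotZl dot_dvecl !mxE !eqxx (eq_sym q).
by case: eqVneq => [->|_] /=; ring.
Qed.

Lemma srefl_triangle p q r k l k' l' : uniq [:: p; q; r] ->
  (srefl p r k l ^ srefl p q k' l')%g = srefl q r (k - k') (l - l').
Proof.
rewrite /= !inE negb_or => /andP[/andP[pq pr] /andP[qr _]].
pose pot (c d : R) i := if i == q then c else if i == r then d else 0.
have potE c d : (pot c d p = 0) * (pot c d q = c) * (pot c d r = d).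
  by rewrite /pot !eqxx (negPf pq) (negPf pr) (eq_sym r) (negPf qr).
have gE := gauge_tperm (pot k' k) (pot l' l).
have [] := (gE p r, gE p q, gE q r); rewrite !potE !subr0 => -[e1 e2 e3].
by rewrite -e1 -e2 -e3 -gmulfJ tpermJ_tperm.
Qed.

End Reflections.

Section Balanced.
Local Open Scope ring_scope.
Variables (R : comNzRingType) (n : nat).
Implicit Types (a b : 'rV[R]_n) (s : {perm 'I_n}) (p q : 'I_n) (h : heis R n).

Definition rsum a : R := dot a (const_mx 1).

Lemma rsumE a : rsum a = \sum_i a 0 i.
Proof. by rewrite /rsum /dot mxE; apply: eq_bigr => i _; rewrite !mxE mulr1. Qed.

Lemma rsumD : {morph rsum : a b / a + b}.
Proof. exact: dotDl. Qed.

Lemma rsum0 : rsum 0 = 0.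
Proof. exact: dot0l. Qed.

Lemma rsum_delta p : rsum (delta_mx 0 p) = 1.
Proof. by rewrite /rsum dot_deltal mxE. Qed.

Lemma rsum_perm a s : rsum (a *m perm_mx s) = rsum a.
Proof.
rewrite /rsum -[in RHS](dot_perm s); congr dot.
by rewrite -[s]invgK -col_permE; apply/rowP => i; rewrite !mxE.
Qed.

Lemma rsumZ_dvec k p q : rsum (k *: dvec R p q) = 0.
Proof. by rewrite /rsum dotZl dot_dvecl !mxE subrr mulr0. Qed.

Definition heis_ab h : R * R := (rsum (hx h), rsum (hy h)).

Lemma heis_abM g h : heis_ab (g * h)%g = heis_ab g + heis_ab h.
Proof. by rewrite /heis_ab /= !rsumD. Qed.

Lemma heis_ab_perm s h : heis_ab (heis_perm s h) = heis_ab h.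
Proof. by rewrite /heis_ab /= !rsum_perm. Qed.

Definition balanced : {pred sheis R n} := [pred m | heis_ab (sh_heis m) == 0].

Lemma balancedE s h : (SHeis s h \in balanced) = (rsum (hx h) == 0) && (rsum (hy h) == 0).
Proof. by []. Qed.

Lemma heis_ab1 : heis_ab 1%g = 0.
Proof. by rewrite /heis_ab /= rsum0. Qed.

Lemma heis_abV h : heis_ab h^-1%g = - heis_ab h.
Proof. by apply: (addIr (heis_ab h)); rewrite -heis_abM mulVg heis_ab1 addNr. Qed.

Lemma subgroup_balanced : subgroup (fun m => m \in balanced).
Proof.
split=> [|m m'|m]; rewrite !inE /= ?heis_ab1 //.
  by rewrite heis_abM heis_ab_perm => /eqP -> /eqP ->; rewrite addr0.
by rewrite heis_abV heis_ab_perm => /eqP ->; rewrite oppr0.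
Qed.

Lemma balanced_lift s : sh_lift R s \in balanced.
Proof. by rewrite inE /= heis_ab1. Qed.

Lemma balanced_srefl p q k l : srefl p q k l \in balanced.
Proof. by rewrite balancedE /= !rsumZ_dvec eqxx. Qed.

Lemma balanced_morphJ (G : groupType) (f : sheis R n -> G) :
  {in balanced &, {morph f : m m' / (m * m')%g}} ->
  {in balanced &, {morph f : m m' / (m ^ m')%g}}.
Proof.
move=> fM m m' mB mB'; apply: (mulgI (f m')).
by rewrite -conjgC -!fM -?conjgC //; apply: (subgroupJ subgroup_balanced).
Qed.

Variable o : 'I_n.

Definition based a : 'rV[R]_n := a - rsum a *: delta_mx 0 o.

Lemma based_id a : rsum a = 0 -> based a = a.
Proof. by rewrite /based => ->; rewrite scale0r subr0. Qed.

Lemma basedD : {morph based : a b / a + b}.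
Proof. by move=> a b; rewrite /based rsumD scalerDl opprD addrACA. Qed.

Lemma basedZ k a : based (k *: a) = k *: based a.
Proof. by rewrite /based scalerBr scalerA -dotZl. Qed.

Lemma based_delta p : based (delta_mx 0 p) = dvec R o p.
Proof. by rewrite /based rsum_delta scale1r. Qed.

Lemma row_sum_dvec a : rsum a = 0 -> a = \sum_i a 0 i *: dvec R o i.
Proof.
move=> a0; rewrite -{1}(based_id a0) {1}(row_sum_delta a).
rewrite (big_morph based basedD (based_id rsum0)).
by apply: eq_bigr => i _; rewrite basedZ based_delta.
Qed.

End Balanced.
Arguments balanced {R n}.

Section BalancedGeneration.
Local Open Scope ring_scope.
Variable n : nat.
Hypothesis n_gt2 : (2 < n)%N.
Variable P : sheis int n -> Prop.
Hypothesis P_subgroup : subgroup P.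
Hypothesis P_lift : forall s, P (sh_lift int s).
Hypothesis P_reflx : forall p q : 'I_n, p != q -> P (srefl p q 1 0).
Hypothesis P_refly : forall p q : 'I_n, p != q -> P (srefl p q 0 1).

Let P_incl (k l : int) p q : P (srefl p q k l) ->
  P (sh_incl (Heis (k *: dvec int p q) (l *: dvec int p q) (- (k * l)))).
Proof.
rewrite /srefl -sh_lift_incl => Pr; case: (P_subgroup) => _ PM _.
by rewrite -[sh_incl _](mulKg (sh_lift int (tperm p q))) -gmulfV; exact: (PM _ _ (P_lift _) Pr).
Qed.

Lemma subgroup_heis_xy p q :
  P (sh_incl (Heis (dvec int p q) 0 0)) /\ P (sh_incl (Heis 0 (dvec int p q) 0)).
Proof.
have [->|pq] := eqVneq p q; first by rewrite dvec_id; case: P_subgroup.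
have := P_incl (P_reflx pq); have := P_incl (P_refly pq).
by rewrite !scale1r !scale0r mul0r mulr0 oppr0.
Qed.

Lemma subgroup_heis_z : P (sh_incl (Heis 0 0 1)).
Proof.
pose o := Ordinal (ltnW (ltnW n_gt2)); pose i := Ordinal (ltnW n_gt2); pose j := Ordinal n_gt2.
have <- : [~ Heis (dvec int o i) 0 0, Heis 0 (dvec int o j) 0]%g = Heis 0 0 1.
  by rewrite heis_commg dot_dvecl dot0l !mxE.
rewrite gmulfR commgEl; case: (P_subgroup) => _ PM PV; apply: (PM); first apply: PV.
  by case: (subgroup_heis_xy o i).
by apply: subgroupJ => //; [case: (subgroup_heis_xy o i) | case: (subgroup_heis_xy o j)].
Qed.

Lemma subgroup_exponential (f : 'rV[int]_n -> sheis int n) (o : 'I_n) : exponential f ->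
  (forall i, P (f (dvec int o i))) -> forall a, rsum a = 0 -> P (f a).
Proof.
move=> fD Pf a /(row_sum_dvec o) ->; case: (P_subgroup) => P1 PM _.
elim/big_ind: _ => [|b c Pb Pc|i _]; first by rewrite (exponential0 fD).
  by rewrite fD; apply: PM.
by rewrite -[a 0 i]intz scaler_int (exponentialMz fD); apply: subgroupXz.
Qed.

Lemma balanced_ind m : m \in balanced -> P m.
Proof.
pose o := Ordinal (ltnW (ltnW n_gt2)).
case: m => s [a b c]; rewrite balancedE /= => /andP[/eqP a0 /eqP b0].
have inclD (f : 'rV[int]_n -> heis int n) : exponential f -> exponential (@sh_incl _ _ \o f).
  by move=> fD v w; rewrite /= fD gmulfM.
rewrite -sh_lift_incl -heis_xyz !gmulfM; case: (P_subgroup) => _ PM _.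
apply: (PM); first exact: P_lift.
apply: (PM); first apply: (PM).
- apply: (subgroup_exponential (inclD _ (@exponential_heis_x _ _)) (o := o)) a0 => i.
  by case: (subgroup_heis_xy o i).
- apply: (subgroup_exponential (inclD _ (@exponential_heis_y _ _)) (o := o)) b0 => i.
  by case: (subgroup_heis_xy o i).
rewrite -[c]intz (exponentialMz (@exponential_heis_z _ _)) gmulfXz.
exact: (subgroupXz _ P_subgroup subgroup_heis_z).
Qed.

End BalancedGeneration.

(** * Equivariant families of reflections *)

Section ReflectionFamilies.
Local Open Scope group_scope.
Variables (T : finType) (G : groupType) (rho : {gmorph {perm T} -> G}).
Implicit Types (p q r : T) (s : {perm T}) (A : T -> T -> G).

Notation tau p q := (rho (tperm p q)).

Lemma gmulf_tperm2 p q : tau p q * tau p q = 1.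
Proof. by rewrite -gmulfM tperm2 gmulf1. Qed.

Lemma gmulf_tpermJ p q s : tau p q ^ rho s = tau (s p) (s q).
Proof. by rewrite -gmulfJ tpermJ. Qed.

Definition equivariant A : Prop := forall s p q, A p q ^ rho s = A (s p) (s q).

(* Properties of the reflections with a fixed displacement from [p] to [q]. *)
Definition refl_family A : Prop :=
  [/\ equivariant A,
      forall p, A p p = 1,
      forall p q, A p q * A p q = 1,
      forall p q r, uniq [:: p; q; r] -> tau q r ^ A p q = A p r &
      forall p q r, uniq [:: p; q; r] -> tau p r ^ A p q = A r q].

Definition pair_perm p q p' q' : {perm T} := tperm p p' * tperm (tperm p p' q) q'.

Lemma pair_permE p q p' q' : p != q -> p' != q' ->
  pair_perm p q p' q' p = p' /\ pair_perm p q p' q' q = q'.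
Proof.
move=> pq pq'; rewrite /pair_perm !permM !tpermL tpermD // 1?eq_sym //.
by rewrite -{1}(tpermL p p') (inj_eq perm_inj).
Qed.

Lemma equivariant_family_exists (w : G) p0 q0 : p0 != q0 ->
  (forall s, s p0 = p0 -> s q0 = q0 -> commute w (rho s)) ->
  exists A, [/\ equivariant A, forall p, A p p = 1 & A p0 q0 = w].
Proof.
move=> pq0 w_stab.
pose A p q := if p == q then 1 else w ^ rho (pair_perm p0 q0 p q).
have AE s p q : p != q -> s p0 = p -> s q0 = q -> w ^ rho s = A p q.
  move=> pq sp sq; have [gp gq] := pair_permE pq0 pq.
  rewrite /A (negPf pq) -(mulgVK (pair_perm p0 q0 p q) s) gmulfM conjgM; congr (_ ^ _).
  apply/conjg_fixP/commgP/w_stab; rewrite permM ?sp ?sq; apply: (canLR (permK _)).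
    by rewrite gp.
  by rewrite gq.
exists A; split=> [s p q|p|]; last by rewrite -(AE 1) ?perm1 // gmulf1 conjg1.
  have [->|pq] := eqVneq p q; first by rewrite /A !eqxx conj1g.
  have [gp gq] := pair_permE pq0 pq; rewrite {1}/A (negPf pq) -conjgM -gmulfM.
  by apply: AE; rewrite ?(inj_eq perm_inj) // permM ?gp ?gq.
by rewrite /A eqxx.
Qed.

Lemma refl_family_exists (w : G) p0 q0 r r' :
  uniq [:: p0; q0; r] -> uniq [:: p0; q0; r'] -> w * w = 1 ->
  (forall s, s p0 = p0 -> s q0 = q0 -> commute w (rho s)) ->
  w * tau q0 r * w = tau q0 r * w * tau q0 r ->
  w * tau p0 r' * w = tau p0 r' * w * tau p0 r' ->
  exists2 A, refl_family A & A p0 q0 = w.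
Proof.
move=> pqr pqr' ww w_stab braid_q braid_p; have pq0 : p0 != q0 by distinct.
have [A [A_eqv A_id A0]] := equivariant_family_exists pq0 w_stab.
exists A => //; split=> // [p q|p q t pqt|p q t pqt].
- have [->|pq] := eqVneq p q; first by rewrite A_id mulg1.
  have [||f [<- <-]] := @perm_map_exists _ [:: p0; q0] [:: p; q] _ _ erefl; try distinct.
  by rewrite -A_eqv -conjMg A0 ww conj1g.
- have [f [<- <- <-]] := perm_map_exists pqr pqt erefl.
  rewrite -!A_eqv -gmulf_tpermJ -conjJg A0 (conjg_braid ww (gmulf_tperm2 _ _) braid_q).
  by rewrite -A0 A_eqv tpermL tpermD //; distinct.
- have [f [<- <- <-]] := perm_map_exists pqr' pqt erefl.
  rewrite -!A_eqv -gmulf_tpermJ -conjJg A0 (conjg_braid ww (gmulf_tperm2 _ _) braid_p).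
  by rewrite -A0 A_eqv tpermL tpermD //; distinct.
Qed.

Lemma refl_family_commute A p q s : refl_family A -> s p = p -> s q = q ->
  commute (A p q) (rho s).
Proof. by case=> A_eqv _ _ _ _ sp sq; apply/commgP/conjg_fixP; rewrite A_eqv sp sq. Qed.

(** * Translations *)

Definition shift A p q : G := tau p q * A p q.

Section OneFamily.
Variable A : T -> T -> G.
Hypothesis A_family : refl_family A.
Notation X := (shift A).

Lemma shift_id p : X p p = 1.
Proof. by case: A_family => _ A_id _ _ _; rewrite /shift A_id tperm1 gmulf1 mulg1. Qed.

Lemma refl_shift p q : A p q = tau p q * X p q.
Proof. by rewrite mulgA gmulf_tperm2 mul1g. Qed.

Lemma shiftJ p q s : X p q ^ rho s = X (s p) (s q).
Proof. by case: A_family => A_eqv _ _ _ _; rewrite conjMg gmulf_tpermJ A_eqv. Qed.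

Lemma shiftV p q : (X p q)^-1 = X q p.
Proof.
rewrite /shift; case: A_family => A_eqv _ A2 _ _.
have -> : A q p = A p q ^ tau p q by rewrite A_eqv tpermL tpermR.
by rewrite (tpermC q) -conjgC invgM (mulg1_eq (A2 p q)) (mulg1_eq (gmulf_tperm2 p q)).
Qed.

Lemma shift_trans_distinct p q r : uniq [:: p; q; r] ->
  X p q * X q r = X p r /\ X q r * X p q = X p r.
Proof.
move=> u; case: A_family => A_eqv _ _ A_right A_left.
have tau_braid a b c : uniq [:: a; b; c] -> tau a b * tau b c * tau a b = tau a c.
  by move=> abc; rewrite -!gmulfM tperm_braid //; distinct.
have [prq rqp] : uniq [:: p; r; q] /\ uniq [:: r; q; p] by split; distinct.
have [pr rq qr pq] : [/\ p != r, r != q, q != r & p != q] by split; distinct.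
split.
  have A_tau : A p q * tau q r = tau q r * A p r by rewrite conjgC A_eqv tpermL tpermD // eq_sym.
  have A_A : A p r * A q r = tau p q * A p r by rewrite [RHS]conjgC A_left.
  by rewrite /shift mulgA -(mulgA _ (A p q)) A_tau -!mulgA A_A !mulgA tau_braid.
have A_tau : A q r * tau p q = tau p q * A p r.
  by rewrite conjgC A_eqv tpermR [tperm p q r]tpermD.
have A_A : A p r * A p q = tau r q * A p r by rewrite [RHS]conjgC A_right.
rewrite /shift mulgA -(mulgA _ (A q r)) A_tau -!mulgA A_A !mulgA.
by rewrite (tpermC q r) (tpermC p q) tau_braid // (tpermC r p).
Qed.

Lemma shift_trans p q r : X p q * X q r = X p r.
Proof.
have [->|pq] := eqVneq p q; first by rewrite shift_id mul1g.
have [->|qr] := eqVneq q r; first by rewrite shift_id mulg1.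
have [<-|pr] := eqVneq p r; first by rewrite -(shiftV p q) mulgV shift_id.
by apply: (proj1 (shift_trans_distinct _)); distinct.
Qed.

Lemma shift_commute p q r t : commute (X p q) (X r t).
Proof.
have XX a b c : commute (X a b) (X b c).
  have [->|ab] := eqVneq a b; first by rewrite shift_id; apply/commute_sym/commute1.
  have [->|bc] := eqVneq b c; first by rewrite shift_id; apply/commute1.
  have [<-|ac] := eqVneq a c; first by rewrite /commute !shift_trans !shift_id.
  by have [|e1 e2] := @shift_trans_distinct a b c; [distinct | rewrite /commute e1 e2].
rewrite -(shift_trans r p t); apply: commuteM; first exact/commute_sym/XX.
by rewrite -(shiftV q p); apply/commute_sym/commuteV/commute_sym/XX.
Qed.

End OneFamily.

Section TwoFamilies.
Variables A B : T -> T -> G.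
Hypothesis A_family : refl_family A.
Hypothesis B_family : refl_family B.
Hypothesis AB_commute : forall p q r t, uniq [:: p; q; r; t] -> commute (A p q) (B r t).
Hypothesis AB_conj : forall p q r t, uniq [:: p; q; r; t] -> B p r ^ A p q = B q t ^ A r t.
Hypothesis card_gt5 : 5 < #|T|.
Notation X := (shift A).
Notation Y := (shift B).

Let fresh (s : seq T) : size s <= 5 -> exists k, k \notin s.
Proof. by move=> s5; apply: exists_notin; apply: leq_ltn_trans s5 card_gt5. Qed.

Lemma shifts_commute p q r t : uniq [:: p; q; r; t] -> commute (X p q) (Y r t).
Proof.
move=> u; have tauD (a b c d : T) : uniq [:: a; b; c; d] -> (tperm a b c = c) * (tperm a b d = d).
  by move=> abcd; rewrite !tpermD //; distinct.
have u' : uniq [:: r; t; p; q] by distinct.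
apply: commuteM; apply/commute_sym/commuteM; try exact/commute_sym/AB_commute.
- by apply/gmulf_commute/commgP/conjg_fixP; rewrite tpermJ !(tauD _ _ _ _ u).
- by apply/commute_sym/refl_family_commute; rewrite ?(tauD _ _ _ _ u').
- by apply/refl_family_commute; rewrite ?(tauD _ _ _ _ u).
Qed.

Lemma shifts_commute_opposite p q r t : uniq [:: p; q; r; t] ->
  commute (X q p * X r t) (Y q r).
Proof.
move=> u; pose W := X p q * X t r.
have [B_eqv _ _ _ _] := B_family.
have BW : commute (B q r) W.
  apply/commgP/conjg_fixP; rewrite conjgM -(shiftV A_family r t).
  apply: (canLR (conjgK _)); rewrite /shift !conjgM !B_eqv tpermR tpermL.
  by rewrite !tpermD; [apply: AB_conj | distinct..].
have tauW : commute W (tau q r).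
  apply/commgP/conjg_fixP; rewrite conjMg !(shiftJ A_family) tpermL tpermR !tpermD; try distinct.
  rewrite -(shift_trans A_family p q r) -(shift_trans A_family t r q).
  rewrite (shift_commute A_family t r r q) mulgA -(mulgA (X p q)) (shift_trans A_family).
  by rewrite (shift_id A_family) mulg1.
have -> : X q p * X r t = W^-1.
  by rewrite invgM !(shiftV A_family) (shift_commute A_family).
by apply/commute_sym/commuteV/commute_sym; apply: commuteM => //; apply: commute_sym.
Qed.

Definition shiftR p q t : G := [~ X p q, Y p t].

Lemma shiftRJ p q t s : shiftR p q t ^ rho s = shiftR (s p) (s q) (s t).
Proof. by rewrite conjRg !shiftJ. Qed.

Lemma shiftR_indep p q t q' t' : uniq [:: p; q; t] -> uniq [:: p; q'; t'] ->
  shiftR p q t = shiftR p q' t'.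
Proof.
have indepX a b c : uniq [:: p; a; b; c] -> shiftR p a b = shiftR p c b.
  move=> u; rewrite /shiftR -(shift_trans A_family p c a) (shift_commute A_family).
  by apply/commMg_commute/shifts_commute; distinct.
have indepY a b c : uniq [:: p; a; b; c] -> shiftR p a b = shiftR p a c.
  move=> u; rewrite /shiftR -(shift_trans B_family p c b) (shift_commute B_family).
  by apply/commgM_commute/shifts_commute; distinct.
move=> u u'; have [k kP] := fresh (s := [:: p; q; t; q'; t']) isT.
rewrite (indepX q t k) ?(indepX q' t' k); try distinct.
by have [->//|tt'] := eqVneq t t'; apply: indepY; distinct.
Qed.

Lemma commuteX_shiftR p q t i j : uniq [:: p; q; t] -> i != p -> j != p ->
  commute (X i j) (shiftR p q t).
Proof.
move=> u ip jp; have [->|ij] := eqVneq i j.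
  by rewrite (shift_id A_family); apply/commute_sym/commute1.
have [q' q'P] := fresh (s := [:: p; i; j]) isT.
have [t' t'P] := fresh (s := [:: p; i; j; q']) isT.
rewrite (@shiftR_indep p q t q' t') //; last distinct.
by apply: commuteR; [apply: shift_commute | apply: shifts_commute; distinct].
Qed.

Lemma commuteY_shiftR p q t i j : uniq [:: p; q; t] -> i != p -> j != p ->
  commute (Y i j) (shiftR p q t).
Proof.
move=> u ip jp; have [->|ij] := eqVneq i j.
  by rewrite (shift_id B_family); apply/commute_sym/commute1.
have [q' q'P] := fresh (s := [:: p; i; j]) isT.
have [t' t'P] := fresh (s := [:: p; i; j; q']) isT.
rewrite (@shiftR_indep p q t q' t') //; last distinct.
apply: commuteR; last exact: shift_commute.
by apply/commute_sym/shifts_commute; distinct.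
Qed.

Lemma shiftR_conj q a b r c d : uniq [:: q; a; b] -> uniq [:: r; c; d] -> q != r ->
  shiftR q a b = shiftR r c d ^ Y q r.
Proof.
move=> uq ur qr; have [p pP] := fresh (s := [:: q; r]) isT.
have [t tP] := fresh (s := [:: q; r; p]) isT.
have u : uniq [:: p; q; r; t] by distinct.
rewrite (@shiftR_indep q a b p r) //; last distinct.
rewrite (@shiftR_indep r c d t q) //; last distinct.
have XpY : X q p ^ Y q r = X q p * shiftR q p r by rewrite /shiftR commgEl mulKVg.
have XtY : X r t ^ Y q r = X r t * (shiftR r t q ^ Y q r)^-1.
  by rewrite /shiftR -(shiftV B_family q r) -conjg_commgV.
apply: (@commute_cancel _ (X q p) (X r t)); first by apply: commuteX_shiftR; distinct.
by rewrite -XpY -XtY -conjMg; apply/conjg_fixP/commgP/shifts_commute_opposite.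
Qed.

Lemma shiftR_const p q t p' q' t' : uniq [:: p; q; t] -> uniq [:: p'; q'; t'] ->
  shiftR p q t = shiftR p' q' t'.
Proof.
move=> u u'; have [pp'|pp'] := eqVneq p p'.
  by rewrite -pp' in u' *; apply: shiftR_indep.
have [r rP] := fresh (s := [:: p; p']) isT.
have [a aP] := fresh (s := [:: r]) isT; have [b bP] := fresh (s := [:: r; a]) isT.
have ur : uniq [:: r; a; b] by distinct.
rewrite (shiftR_conj u ur) ?(shiftR_conj u' ur); try distinct.
rewrite -(shift_trans B_family p p' r) conjgM; congr (_ ^ _).
by apply/conjg_fixP/commgP/commute_sym/commuteY_shiftR; distinct.
Qed.

Lemma shifts_centre : exists Z : G,
  [/\ forall p q t, uniq [:: p; q; t] -> [~ X p q, Y p t] = Z,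
      forall p q, commute (X p q) Z, forall p q, commute (Y p q) Z &
      forall s, commute Z (rho s)].
Proof.
have [o _] := fresh (s := [::]) isT; have [i iP] := fresh (s := [:: o]) isT.
have [j jP] := fresh (s := [:: o; i]) isT.
have u : uniq [:: o; i; j] by distinct.
have avoid p q : exists r a b, [/\ uniq [:: r; a; b], p != r & q != r].
  have [r rP] := fresh (s := [:: p; q]) isT; have [a aP] := fresh (s := [:: r]) isT.
  by have [b bP] := fresh (s := [:: r; a]) isT; exists r, a, b; split; distinct.
exists (shiftR o i j); split=> [p q t upqt|p q|p q|s]; first exact: shiftR_const.
- have [r [a [b [uR pr qr]]]] := avoid p q.
  by rewrite (shiftR_const u uR); apply: commuteX_shiftR.
- have [r [a [b [uR pr qr]]]] := avoid p q.
  by rewrite (shiftR_const u uR); apply: commuteY_shiftR.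
apply/commgP/conjg_fixP; rewrite shiftRJ; apply: shiftR_const => //.
by rewrite (map_inj_uniq perm_inj [:: o; i; j]).
Qed.

End TwoFamilies.
End ReflectionFamilies.

(** * The morphism from the balanced subgroup defined by two families *)

Section BasedShifts.
Local Open Scope group_scope.
Variables (n : nat) (G : groupType) (rho : {gmorph {perm 'I_n} -> G}) (o : 'I_n).
Variable A : 'I_n -> 'I_n -> G.
Hypothesis A_family : refl_family rho A.
Notation X := (shift rho A).

Lemma prodz_shiftD : exponential (prodz (X o)).
Proof. by apply: prodzD => i j; apply: shift_commute. Qed.

Lemma prodz_shift_dvec p q : prodz (X o) (dvec int p q) = X p q.
Proof.
rewrite prodz_shiftD (exponentialN prodz_shiftD) !prodz_delta (shiftV A_family).
by rewrite (shift_commute A_family) (shift_trans A_family).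
Qed.

Lemma prodz_shiftJ (s : {perm 'I_n}) (a : 'rV[int]_n) : rsum a = 0%R ->
  prodz (X o) a ^ rho s = prodz (X o) (a *m perm_mx s).
Proof.
move=> a0; suff -> : prodz (X o) a ^ rho s
    = prodz (X o) (a *m perm_mx s) * expgz (X (s o) o) (rsum a) by rewrite a0 mulg1.
move: a {a0}; apply: exponential_rV_ext => [v w||i].
- by rewrite prodz_shiftD conjMg.
- apply: exponentialM => [v w|v w|].
  + apply/commuteXz/commute_sym/commute_prodz => j; exact: shift_commute.
  + by rewrite mulmxDl prodz_shiftD.
  + exact/exponential_expgz/rsumD.
rewrite delta_perm !prodz_delta shiftJ // rsum_delta expgz1.
by rewrite (shift_commute A_family) (shift_trans A_family).
Qed.

End BasedShifts.

Section NormalForm.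
Local Open Scope group_scope.
Variables (n : nat) (G : groupType) (rho : {gmorph {perm 'I_n} -> G}) (o : 'I_n).
Variables A B : 'I_n -> 'I_n -> G.
Hypothesis A_family : refl_family rho A.
Hypothesis B_family : refl_family rho B.
Notation X := (shift rho A).
Notation Y := (shift rho B).
Variable Z : G.
Hypothesis XY : forall p q r, uniq [:: p; q; r] -> [~ X p q, Y p r] = Z.
Hypothesis XZ : forall p q, commute (X p q) Z.
Hypothesis YZ : forall p q, commute (Y p q) Z.
Hypothesis rhoZ : forall s, commute Z (rho s).
Hypothesis n_gt2 : 2 < n.

Definition based_dot (a b : 'rV[int]_n) : int := dot (based o a) (based o b).

Lemma commg_shift_same i : i != o -> [~ X o i, Y o i] = expgz Z 2.
Proof.
move=> io; have [k kP] : exists k, k \notin [:: o; i] by apply: exists_notin; rewrite card_ord.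
have XkiYoi : [~ X k i, Y o i] = Z.
  have e : [~ X i k, Y i o] = Z by apply: XY; distinct.
  rewrite -(shiftV A_family i k) -(shiftV B_family i o) commVgV ?e //.
have XokYoi : [~ X o k, Y o i] = Z by apply: XY; distinct.
by rewrite -(shift_trans A_family o k i) commMg_central ?XokYoi ?XkiYoi.
Qed.

Lemma commg_shift_base i j :
  [~ X o i, Y o j] = expgz Z (based_dot (delta_mx ord0 i) (delta_mx ord0 j)).
Proof.
rewrite /based_dot !based_delta dot_dvecl !mxE !eqxx (eq_sym o j).
have [->|io] := eqVneq i o; first by rewrite (shift_id A_family) comm1g (eq_sym o) subrr.
have [->|jo] := eqVneq j o; first by rewrite (shift_id B_family) commg1 (negPf io).
rewrite (eq_sym i); have [->|ji] := eqVneq j i; first exact: commg_shift_same.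
by apply: XY; distinct.
Qed.

Definition shift_word := heis_word (X o) (Y o) Z.

Definition model_word (m : sheis int n) : G :=
  rho (sh_perm m) * shift_word (hx (sh_heis m)) (hy (sh_heis m)) (hz (sh_heis m)).

Lemma shift_wordJ s a b c : rsum a = 0%R -> rsum b = 0%R ->
  shift_word a b c ^ rho s = shift_word (a *m perm_mx s) (b *m perm_mx s) c.
Proof.
move=> a0 b0; rewrite /shift_word /heis_word !conjMg !prodz_shiftJ //; congr (_ * _).
exact/conjg_fixP/commgP/commute_sym/commuteXz/commute_sym.
Qed.

Lemma model_wordM : {in balanced &, {morph model_word : m m' / m * m'}}.
Proof.
move=> [s [a b c]] [s' [a' b' c']]; rewrite !balancedE /=.
move=> /andP[/eqP a0 /eqP b0] /andP[/eqP a0' /eqP b0'].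
rewrite /model_word /= gmulfM [RHS]mulgACJ; congr (_ * _).
rewrite shift_wordJ // /shift_word (heis_wordM (form := based_dot)) //.
- by rewrite /based_dot !based_id // rsum_perm.
- by move=> i j; apply: shift_commute.
- by move=> i j; apply: shift_commute.
- by move=> i; apply: commute_sym.
- by move=> i; apply: commute_sym.
- by move=> v w w'; rewrite /based_dot basedD dotDl.
- by move=> v w w'; rewrite /based_dot basedD dotDr.
- exact: commg_shift_base.
Qed.

Lemma model_word_lift s : model_word (sh_lift int s) = rho s.
Proof.
rewrite /model_word /shift_word /heis_word /=.
by rewrite !(exponential0 (prodz_shiftD _ _)) // !mulg1.
Qed.

Lemma model_word_reflx p q : model_word (srefl p q 1%R 0%R) = A p q.
Proof.
rewrite /model_word /shift_word /heis_word /= scale1r scale0r prodz_shift_dvec //.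
by rewrite (exponential0 (prodz_shiftD _ B_family)) !mulg1 -refl_shift.
Qed.

Lemma model_word_refly p q : model_word (srefl p q 0%R 1%R) = B p q.
Proof.
rewrite /model_word /shift_word /heis_word /= scale1r scale0r prodz_shift_dvec //.
by rewrite (exponential0 (prodz_shiftD _ A_family)) mul1g mulg1 -refl_shift.
Qed.

End NormalForm.

Lemma balanced_morphism (n : nat) (G : groupType) (rho : {gmorph {perm 'I_n} -> G})
    (A B : 'I_n -> 'I_n -> G) : 5 < n -> refl_family rho A -> refl_family rho B ->
  (forall p q r t, uniq [:: p; q; r; t] -> commute (A p q) (B r t)) ->
  (forall p q r t, uniq [:: p; q; r; t] -> (B p r ^ A p q = B q t ^ A r t)%g) ->
  exists f : sheis int n -> G,
    [/\ {in balanced &, {morph f : m m' / (m * m')%g}},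
        forall s, f (sh_lift int s) = rho s,
        forall p q, f (srefl p q 1%R 0%R) = A p q &
        forall p q, f (srefl p q 0%R 1%R) = B p q].
Proof.
move=> n_gt5 A_family B_family AB_commute AB_conj.
have [|Z [XY XZ YZ rhoZ]] := shifts_centre A_family B_family AB_commute AB_conj.
  by rewrite card_ord.
have n_gt2 : 2 < n by apply: leq_trans n_gt5.
pose o := Ordinal (ltnW (ltnW n_gt2)).
exists (model_word rho o A B Z); split=> [|s|p q|p q].
- exact: model_wordM.
- exact: model_word_lift.
- exact: model_word_reflx.
- exact: model_word_refly.
Qed.

(** * The graph and the reflections of the model *)

Definition is_vertex (v : nat) : bool := 0 < v <= 18.
Definition is_edge (k : nat) : bool := 0 < k <= 27.

Lemma vtx_eq a b : is_vertex a -> is_vertex b -> (vtx a == vtx b) = (a == b).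
Proof. by rewrite /is_vertex /vtx => a18 b18; rewrite inord_eq; lia. Qed.

Lemma vtxK a : is_vertex a -> (vtx a).+1 = a.
Proof. by rewrite /is_vertex => a18; rewrite inordK; lia. Qed.

Lemma vtx_ord (i : 'I_18) : vtx i.+1 = i.
Proof. exact: inord_val. Qed.

Lemma is_vertex_ord (i : 'I_18) : is_vertex i.+1.
Proof. exact: ltn_ord. Qed.

Lemma edg_ord (j : 'I_27) : edg j.+1 = j.
Proof. exact: inord_val. Qed.

Lemma is_edge_ord (j : 'I_27) : is_edge j.+1.
Proof. exact: ltn_ord. Qed.

Lemma mem_iota_vertex v : (v \in iota 1 18) = is_vertex v.
Proof. by rewrite mem_iota. Qed.

Lemma mem_iota_edge k : (k \in iota 1 27) = is_edge k.
Proof. by rewrite mem_iota. Qed.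

Lemma uniq_vtx s : all is_vertex s -> uniq s -> uniq (map vtx s).
Proof.
move=> s18 us; rewrite map_inj_in_uniq // => a b /(allP s18) a18 /(allP s18) b18 /eqP.
by rewrite vtx_eq // => /eqP.
Qed.

Definition edge (k : nat) : nat * nat := nth (0, 0) edges k.-1.

Lemma edg_val k : is_edge k -> edg k = k.-1 :> nat.
Proof. by rewrite /is_edge => k27; rewrite inordK //; lia. Qed.

Lemma ep_edg k : is_edge k -> (ep1 (edg k) = vtx (edge k).1) * (ep2 (edg k) = vtx (edge k).2).
Proof. by move=> k27; rewrite /ep1 /ep2 edg_val. Qed.

Lemma is_vertex_edge k : is_edge k -> is_vertex (edge k).1 && is_vertex (edge k).2.
Proof.
have /(all_nthP (0, 0)) edges18 : all (fun e => is_vertex e.1 && is_vertex e.2) edges by [].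
by case/andP=> k_gt0 k27; apply: edges18; rewrite prednK.
Qed.

Definition joins k a b : bool := (edge k == (a, b)) || (edge k == (b, a)).

Definition adjacent (k l : nat) : bool :=
  let e := edge k in let e' := edge l in
  [|| e.1 == e'.1, e.1 == e'.2, e.2 == e'.1 | e.2 == e'.2].

Lemma share_edg k l : is_edge k -> is_edge l -> share (edg k) (edg l) = adjacent k l.
Proof.
move=> k27 l27; have /andP[? ?] := is_vertex_edge k27; have /andP[? ?] := is_vertex_edge l27.
by rewrite /share !ep_edg // !vtx_eq.
Qed.

Definition swap (a b c : nat) : nat := if c == a then b else if c == b then a else c.

Lemma tperm_vtx a b c : is_vertex a -> is_vertex b -> is_vertex c ->
  tperm (vtx a) (vtx b) (vtx c) = vtx (swap a b c).
Proof.
move=> a18 b18 c18; rewrite /swap; case: eqP => [->|/eqP ca]; first by rewrite tpermL.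
case: eqP => [->|/eqP cb]; first by rewrite tpermR.
by rewrite tpermD // vtx_eq // eq_sym.
Qed.

Definition tperm_edge (k : nat) : {perm 'I_18} := tperm (ep1 (edg k)) (ep2 (edg k)).

Lemma tperm_edgeE k a b : is_edge k -> joins k a b -> tperm_edge k = tperm (vtx a) (vtx b).
Proof. by move=> k27 /orP[] /eqP ek; rewrite /tperm_edge !ep_edg // ek // tpermC. Qed.

Section Words.
Local Open Scope group_scope.

Definition word_act (w : seq nat) (v : nat) : nat :=
  foldl (fun v k => swap (edge k).1 (edge k).2 v) v w.

Lemma prod_tperm_edge w v : all is_edge w -> is_vertex v ->
  (\prod_(k <- w) tperm_edge k) (vtx v) = vtx (word_act w v).
Proof.
elim: w v => [|k w IHw] v /=; first by rewrite big_nil perm1.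
case/andP=> k27 w27 v18; have /andP[e1 e2] := is_vertex_edge k27.
rewrite big_cons permM /tperm_edge !ep_edg // tperm_vtx // IHw // /swap.
by do ![case: ifP].
Qed.

Definition same_perm (w w' : seq nat) : bool :=
  all (fun v => word_act w v == word_act w' v) (iota 1 18).

Lemma prod_tperm_edge_eq w w' : all is_edge w -> all is_edge w' -> same_perm w w' ->
  \prod_(k <- w) tperm_edge k = \prod_(k <- w') tperm_edge k.
Proof.
move=> w27 w27' /allP ww'; apply/permP => i; have i18 := is_vertex_ord i.
by rewrite -(vtx_ord i) !prod_tperm_edge //; congr vtx; apply/eqP/ww'; rewrite mem_iota_vertex.
Qed.

End Words.

Section ModelReflections.
Local Open Scope ring_scope.

(* Displacement in the universal cover of the torus along each edge, oriented
   from the first to the second listed endpoint; it vanishes along the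
   Hamiltonian path [hpath] below. *)
Definition volts : seq (int * int) :=
  [:: (0, 0); (0, 0); (0, 0); (-1, 0); (0, 0); (0, 0); (0, 0); (0, 1); (0, 0);
      (0, 0); (0, 0); (0, 0); (1, 0); (0, 0); (-1, 1); (0, 0); (0, 0); (0, 0);
      (0, 0); (0, 0); (0, 0); (0, 0); (0, 0); (0, 1); (0, 0); (0, -1); (0, 0)].

Definition volt (k : nat) : int * int := nth (0, 0) volts k.-1.

Definition sgen (j : 'I_27) : sheis int 18 :=
  srefl (ep1 j) (ep2 j) (volt j.+1).1 (volt j.+1).2.

Lemma sgen_edg k : is_edge k ->
  sgen (edg k) = srefl (vtx (edge k).1) (vtx (edge k).2) (volt k).1 (volt k).2.
Proof.
by move=> k27; rewrite /sgen !ep_edg // edg_val // prednK //; case/andP: k27.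
Qed.

Definition pot_at (pot : seq (nat * (int * int))) (v : nat) : int * int :=
  nth (0, 0) (unzip2 pot) (index v (unzip1 pot)).

(* A function on the vertices whose increments along the edges [ks], taken one
   by one, are their displacements, if there is one. *)
Fixpoint potential (pot : seq (nat * (int * int))) (ks : seq nat) : seq (nat * (int * int)) :=
  if ks is k :: ks' then
    let: (a, b) := edge k in
    let pot' :=
      if a \in unzip1 pot then [:: (b, pot_at pot a + volt k)]
      else if b \in unzip1 pot then [:: (a, pot_at pot b - volt k)]
      else [:: (a, 0); (b, volt k)] in
    potential (pot' ++ pot) ks'
  else pot.

Definition exact_on (ks : seq nat) : bool :=
  let pot := pot_at (potential [::] ks) in
  all (fun k => is_edge k && (volt k == pot (edge k).2 - pot (edge k).1)) ks.

Lemma sgen_gauge ks : exact_on ks ->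
  exists phi chi, {in ks, forall k, sgen (edg k) = gauge phi chi (tperm_edge k)}.
Proof.
move=> /allP exact_ks; set pot := pot_at _ in exact_ks.
exists (fun i : 'I_18 => (pot i.+1).1), (fun i : 'I_18 => (pot i.+1).2) => k kin.
have /andP[k27 /eqP volt_k] := exact_ks k kin; have /andP[e1 e2] := is_vertex_edge k27.
by rewrite sgen_edg // /tperm_edge gauge_tperm !ep_edg // !vtxK // volt_k.
Qed.

Lemma prod_sgen_eq w w' : exact_on (w ++ w') -> same_perm w w' ->
  (\prod_(k <- w) sgen (edg k) = \prod_(k <- w') sgen (edg k))%g.
Proof.
move=> ex ww'; have [phi [chi sgenE]] := sgen_gauge ex.
have w27 : all is_edge (w ++ w') by apply: sub_all ex => k /andP[].
rewrite all_cat in w27; case/andP: w27 => w27 w27'.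
have prodE v : {subset v <= w ++ w'} ->
    (\prod_(k <- v) sgen (edg k) = gauge phi chi (\prod_(k <- v) tperm_edge k))%g.
  by move=> vw; rewrite gmulf_prod; apply: eq_big_seq => k /vw; apply: sgenE.
by rewrite !prodE ?(prod_tperm_edge_eq w27 w27') // => k kw; rewrite mem_cat kw ?orbT.
Qed.

End ModelReflections.

(** * Abstract groups *)

(* The groups of the library carry a choice structure, which an abstract carrier
   only has classically. *)
HB.instance Definition _ (G : agroup) := gen_eqMixin (gcar G).
HB.instance Definition _ (G : agroup) := gen_choiceMixin (gcar G).

Lemma gmulgV (G : agroup) : right_inverse gone ginv (@gmul G).
Proof.
move=> a; rewrite -[LHS]gmul1 -[X in X ** _](gmulV (ginv a)) gmulA -(gmulA _ _ a).
by rewrite gmulV -gmulA gmul1 gmulV.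
Qed.

Lemma gmulg1 (G : agroup) : right_id gone (@gmul G).
Proof. by move=> a; rewrite -(gmulV a) gmulA gmulgV gmul1. Qed.

HB.instance Definition _ (G : agroup) :=
  isGroup.Build (gcar G) (@gmulA G) (@gmul1 G) (@gmulg1 G) (@gmulV G) (@gmulgV G).

Definition agroup_of (G : groupType) : agroup := AGroup (@mulgA G) (@mul1g G) (@mulVg G).

Lemma gpowE (G : agroup) (x : G) n : gpow x n = expgz x n.
Proof.
have gpownE m : gpown x m = (x ^+ m)%g by elim: m => //= m ->; rewrite expgSr.
by case: n => n; rewrite /= gpownE ?expgSr.
Qed.

Lemma gcommE (G : agroup) (x y : G) : gcomm x y = [~ x, y]%g.
Proof. by rewrite commgEl conjgE !mulgA. Qed.

Lemma prodg_seq5 (G : groupType) (F : nat -> G) a b c d e :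
  (\prod_(k <- [:: a; b; c; d; e]) F k = F a * F b * F c * F d * F e)%g.
Proof. by rewrite !big_cons big_nil mulg1 !mulgA. Qed.

Lemma hexagon_seq6 h : h \in hexagons -> exists a b c d e f, h = [:: a; b; c; d; e; f].
Proof.
have /allP size6 : all (fun h => size h == 6) hexagons by [].
move=> /size6; case: h => [|a [|b [|c [|d [|e [|f []]]]]]] // _.
by exists a, b, c, d, e, f.
Qed.

(* Along the edges of a relation that holds in [S_18] the displacements derive from
   a potential, so the relation holds for the reflections of the model. *)
Definition exact_relation (w w' : seq nat) : bool := exact_on (w ++ w') && same_perm w w'.

Lemma prod_sgen_relation w w' : exact_relation w w' ->
  (\prod_(k <- w) sgen (edg k) = \prod_(k <- w') sgen (edg k))%g.
Proof. by case/andP; apply: prod_sgen_eq. Qed.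

Lemma sgen_CRel : @CRel (agroup_of (sheis int 18)) sgen.
Proof.
have /allP square_rel : all (fun k => exact_relation [:: k; k] [::]) (iota 1 27) by vm_compute.
have /allrelP commute_rel : allrel (fun k l => ~~ adjacent k l ==>
    exact_relation [:: k; l] [:: l; k]) (iota 1 27) (iota 1 27) by vm_compute.
have /allrelP braid_rel : allrel (fun k l => (k != l) && adjacent k l ==>
    exact_relation [:: k; l; k] [:: l; k; l]) (iota 1 27) (iota 1 27) by vm_compute.
have /allP hexagon_rel : all (fun h => exact_relation (take 5 h) (drop 1 h)) hexagons.
  by vm_compute.
have label (j : 'I_27) : j.+1 \in iota 1 27 by rewrite mem_iota_edge is_edge_ord.
have adjacentE (i j : 'I_27) : adjacent i.+1 j.+1 = share i j.
  by rewrite -share_edg ?is_edge_ord // !edg_ord.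
split=> [j|i j|i j|h h_hex].
- have := prod_sgen_relation (square_rel _ (label j)).
  by rewrite big_nil big_cons big_seq1 edg_ord.
- have := commute_rel _ _ (label i) (label j); rewrite adjacentE.
  move=> /implyP rel_ij /rel_ij /prod_sgen_relation.
  by rewrite !big_cons !big_nil !mulg1 !edg_ord.
- have := braid_rel _ _ (label i) (label j); rewrite adjacentE eqSS => /implyP rel_ij ij ij_share.
  have /prod_sgen_relation := rel_ij (introT andP (conj ij ij_share)).
  by rewrite !big_cons !big_nil !mulg1 !edg_ord !mulgA.
have [a [b [c [d [e [f eh]]]]]] := hexagon_seq6 h_hex.
by have := prod_sgen_relation (hexagon_rel h h_hex); rewrite eh !prodg_seq5.
Qed.

(** * Consequences of the relations *)

Lemma hexagon_rotation (G : groupType) (a b c d e f : G) : (b * b = 1)%g ->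
  (a * b * a = b * a * b)%g -> commute a c -> commute a d -> commute a e ->
  (a * b * c * d * e = b * c * d * e * f)%g -> (b * c * d * e * f = c * d * e * f * a)%g.
Proof.
move=> bb aba ac ad ae hex.
have cdef : (c * d * e * f = b * a * b * (c * d * e))%g.
  by apply: (mulgI b); rewrite !mulgA -hex bb mul1g.
have a_cde : commute a (c * d * e)%g by do 2?apply: commuteM.
have baba : (b * a * b * a = a * b)%g.
  by rewrite -(mulgA b a) -(mulgA b) aba !mulgA bb mul1g.
by rewrite -hex cdef -(mulgA (b * a * b)%g) -a_cde mulgA baba !mulgA.
Qed.

Lemma commute_conjKg (G : groupType) (x y z : G) :
  commute x z -> commute x (y ^ z)%g -> commute x y.
Proof.
move=> xz xyz; rewrite -(conjgK z y).
exact: subgroupJ (subgroup_commute x) xyz (commuteV xz).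
Qed.

(* A Hamiltonian path: its edges generate a copy of the symmetric group by the
   Coxeter relations alone. *)
Definition hpath := [:: 3; 2; 7; 11; 12; 10; 18; 17; 9; 4; 6; 14; 16; 8; 5; 1; 13; 15].
Definition hedges := [:: 6; 1; 14; 21; 19; 20; 27; 18; 3; 9; 12; 25; 16; 11; 5; 2; 22].

Lemma hpath_inj : injective (fun i : 'I_18 => vtx (nth 0 hpath i)).
Proof.
have vertex (i : 'I_18) : is_vertex (nth 0 hpath i).
  by have /(all_nthP 0) : all is_vertex hpath by []; apply.
by move=> i j /eqP; rewrite vtx_eq // nth_uniq // => /eqP/val_inj.
Qed.

Definition hperm : {perm 'I_18} := perm hpath_inj.

Lemma hperm_inord i : i < 18 -> hperm (inord i) = vtx (nth 0 hpath i).
Proof. by move=> i18; rewrite permE inordK. Qed.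

Lemma is_edge_hedges k : k \in hedges -> is_edge k.
Proof. by move: k; apply/allP. Qed.

Lemma joins_hedges i : i < 17 -> joins (nth 0 hedges i) (nth 0 hpath i) (nth 0 hpath i.+1).
Proof.
move=> i17; have /allP path_joins :
  all (fun i => joins (nth 0 hedges i) (nth 0 hpath i) (nth 0 hpath i.+1)) (iota 0 17) by [].
by apply: path_joins; rewrite mem_iota.
Qed.

Section Relations.
Local Open Scope group_scope.
Variables (G : agroup) (u : 'I_27 -> G).
Hypothesis uC : CRel u.
Notation U k := (u (edg k)).

Lemma gen_square k : U k * U k = 1.
Proof. by case: uC => sq _ _ _; apply: sq. Qed.

Lemma gen_commute k l : is_edge k -> is_edge l -> ~~ adjacent k l -> commute (U k) (U l).
Proof. by case: uC => _ cm _ _ k27 l27; rewrite -share_edg //; apply: cm. Qed.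

Lemma gen_braid k l : is_edge k -> is_edge l -> k != l -> adjacent k l ->
  U k * U l * U k = U l * U k * U l.
Proof.
case: uC => _ _ br _ k27 l27 kl; rewrite -share_edg //; apply: br.
by rewrite -val_eqE /= !edg_val //; move: kl k27 l27; rewrite /is_edge; lia.
Qed.

Definition rotatable (h : seq nat) : bool :=
  if h is [:: a; b; c; d; e; f] then
    [&& all is_edge h, a != b, adjacent a b, ~~ adjacent a c, ~~ adjacent a d & ~~ adjacent a e]
  else false.

Lemma hex_rel_rot h : rotatable h -> hex_rel u h -> hex_rel u (rot 1 h).
Proof.
case: h => [|a [|b [|c [|d [|e [|f []]]]]]] //=.
case/and5P=> /and5P[a27 b27 c27 d27 /and3P[e27 _ _]] ab a_b a_c /andP[a_d a_e].
apply: hexagon_rotation; [exact: gen_square | exact: gen_braid | ..]; exact: gen_commute.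
Qed.

Definition rotated_hexagons : seq (seq nat) := [seq rot n h | h <- hexagons, n <- iota 0 6].

Lemma hex_rel_rotated h : h \in rotated_hexagons -> hex_rel u h.
Proof.
case/allpairsP=> -[h' n] [+ + ->]; rewrite mem_iota /= add0n => h_hex.
have /allP : all (fun h => all (fun n => rotatable (rot n h)) (iota 0 6)) hexagons.
  by vm_compute.
move=> /(_ h' h_hex) /allP rotatable_h.
have size_h : size h' = 6 by have [? [? [? [? [? [? ->]]]]]] := hexagon_seq6 h_hex.
elim: n => [|n IHn] n6; first by case: uC => _ _ _; rewrite rot0; apply.
rewrite rotS ?size_h; last exact: ltnW.
apply: hex_rel_rot; last exact: IHn (ltnW n6).
by apply: rotatable_h; rewrite mem_iota; apply: ltnW.
Qed.

Lemma hexagonJ a b c d e f : [:: a; b; c; d; e; f] \in rotated_hexagons ->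
  U f = (((U a ^ U b) ^ U c) ^ U d) ^ U e.
Proof.
move=> /hex_rel_rotated; rewrite /hex_rel /= => hexE.
rewrite -!conjgM !mulgA; apply: (mulgI (U b * U c * U d * U e)).
by rewrite -conjgC !mulgA.
Qed.

Lemma hedges_coxeter : coxeter 17 (fun i => U (nth 0 hedges i)).
Proof.
have edge_nth i : i < 17 -> is_edge (nth 0 hedges i).
  by move=> i17; apply/is_edge_hedges/mem_nth.
split=> [i _|i j ij j17|i i17]; first exact: gen_square.
  apply: gen_commute; rewrite ?edge_nth //; first by apply: ltn_trans j17; apply: ltnW.
  have /allrelP : allrel (fun i j => (i.+1 < j) ==> ~~ adjacent (nth 0 hedges i) (nth 0 hedges j))
     (iota 0 17) (iota 0 17) by vm_compute.
  by move=> /(_ i j); rewrite !mem_iota ij; apply; rewrite // /=; lia.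
have /allP : all (fun i => (nth 0 hedges i != nth 0 hedges i.+1)
    && adjacent (nth 0 hedges i) (nth 0 hedges i.+1)) (iota 0 16) by vm_compute.
move=> /(_ i); rewrite mem_iota => /(_ i17) /andP[ne adj].
by apply: gen_braid; rewrite ?edge_nth // ltnW.
Qed.

Lemma hpath_morphism : exists rho : {gmorph {perm 'I_18} -> G},
  {in hedges, forall k, U k = rho (tperm_edge k)}.
Proof.
have [f f_adjt] := coxeter_morphism hedges_coxeter.
have fJ : {morph (fun s => f (s ^ hperm^-1)) : s s' / s * s'}.
  by move=> s s'; rewrite conjMg gmulfM.
exists (gmorph_of fJ) => k kin; rewrite /= -(nth_index 0 kin).
have i17 : index k hedges < 17 by rewrite index_mem.
rewrite -f_adjt //; congr (f _); rewrite (tperm_edgeE _ (joins_hedges i17)); last first.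
  by rewrite nth_index // is_edge_hedges.
by rewrite -!hperm_inord ?(leqW i17) // tpermJ !permK.
Qed.

End Relations.

Definition tree_spans (avoid : seq nat) (r : nat) (es : seq (nat * nat)) : bool :=
  grows [:: r] es && all (fun v => (v \in avoid) || (v \in r :: map snd es)) (iota 1 18).

Lemma subgroup_fixing (P : {perm 'I_18} -> Prop) avoid r es : subgroup P ->
  tree_spans avoid r es -> {in es, forall e, P (tperm (vtx e.1) (vtx e.2))} ->
  forall s : {perm 'I_18}, {in avoid, forall v, s (vtx v) = vtx v} -> P s.
Proof.
move=> subP /andP[gr /allP cov] Pes s s_fix; have Pr := subgroup_tree subP gr Pes.
pose moved := [set i : 'I_18 | i.+1 \notin avoid].
apply: (subgroup_perm_on subP (A := moved) (r := vtx r)).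
  move=> i; rewrite inE -(vtx_ord i) => i_moved.
  have := cov i.+1; rewrite mem_iota_vertex is_vertex_ord => /(_ isT).
  by rewrite vtx_ord in i_moved *; rewrite (negPf i_moved) => /Pr; rewrite vtx_ord.
apply/subsetP => i; rewrite !inE; apply: contraNN => /s_fix.
by rewrite vtx_ord => ->.
Qed.

Section Reconstruction.
Variables (G : agroup) (u : 'I_27 -> G).
Hypothesis uC : CRel u.
Notation U k := (u (edg k)).
Variable rho : {gmorph {perm 'I_18} -> G}.
Hypothesis rho_hedges : {in hedges, forall k, U k = rho (tperm_edge k)}.
Notation t a b := (rho (tperm (vtx a) (vtx b))).

Lemma hedge_tperm k a b : k \in hedges -> joins k a b -> U k = t a b.
Proof. by move=> kin k_ab; rewrite rho_hedges // (tperm_edgeE _ k_ab) // is_edge_hedges. Qed.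

Lemma hedgeE k : k \in hedges -> U k = t (edge k).1 (edge k).2.
Proof. by move=> kin; apply: hedge_tperm; rewrite // /joins -surjective_pairing eqxx. Qed.

Lemma hedge_commute w a b : is_edge w ->
  has (fun k => joins k a b && ~~ adjacent w k) hedges -> commute (U w) (t a b).
Proof.
move=> w27 /hasP[k kin /andP[k_ab w_k]]; rewrite -(hedge_tperm kin k_ab).
by apply: gen_commute => //; apply: is_edge_hedges.
Qed.

Lemma hedge_braid w k a b : is_edge w -> w != k -> adjacent w k -> k \in hedges -> joins k a b ->
  (U w * t a b * U w = t a b * U w * t a b)%g.
Proof.
move=> w27 wk w_k kin k_ab; rewrite -(hedge_tperm kin k_ab).
by apply: gen_braid => //; apply: is_edge_hedges.
Qed.

Lemma commute_stabilizer w p q r es e0 : is_edge w -> tree_spans [:: p; q] r es ->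
  all (fun e => (e == e0) || has (fun k => joins k e.1 e.2 && ~~ adjacent w k) hedges) es ->
  commute (U w) (t e0.1 e0.2) ->
  forall s : {perm 'I_18}, s (vtx p) = vtx p -> s (vtx q) = vtx q -> commute (U w) (rho s).
Proof.
move=> w27 tree /allP es_ok w_e0 s sp sq.
apply: (subgroup_fixing (subgroup_preim rho (subgroup_commute (U w))) tree) => [e /es_ok|v].
  by case/predU1P=> [->|] //; apply: hedge_commute.
by rewrite !inE => /orP[] /eqP ->.
Qed.

Lemma tperm_vtxJ a b c d : is_vertex a -> is_vertex b -> is_vertex c -> is_vertex d ->
  (t a b ^ t c d = t (swap c d a) (swap c d b))%g.
Proof. by move=> *; rewrite gmulf_tpermJ !tperm_vtx. Qed.

Lemma commute_hexagon k a b c d e f : [:: a; b; c; d; e; f] \in rotated_hexagons ->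
  commute (U k) (U c) -> commute (U k) (U d) -> commute (U k) (U e) -> commute (U k) (U f) ->
  commute (U k) (U a ^ U b)%g.
Proof.
move=> hex kc kd ke; rewrite (hexagonJ uC hex) => kf.
exact: commute_conjKg kc (commute_conjKg kd (commute_conjKg ke kf)).
Qed.

(* A hexagon forces [u_13] and [u_8] to commute with the transposition of the two
   neighbours on the path of their inner endpoint. *)
Lemma family_through_13 : exists2 A, refl_family rho A & A (vtx 7) (vtx 15) = U 13.
Proof.
have commute_2_11 : commute (U 13) (t 2 11).
  have := @commute_hexagon 13 14 1 7 9 3 17.
  rewrite (@hedge_tperm 14 7 11) // (@hedge_tperm 1 2 7) //.
  by rewrite tperm_vtxJ // tpermC; apply=> //; apply: (gen_commute uC).
apply: (@refl_family_exists _ _ _ _ _ _ (vtx 13) (vtx 2)).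
- exact: (@uniq_vtx [:: 7; 15; 13]).
- exact: (@uniq_vtx [:: 7; 15; 2]).
- exact: gen_square.
- by apply: (@commute_stabilizer 13 7 15 3 [:: (3, 2); (2, 11); (11, 12); (12, 10); (10, 18);
    (18, 17); (17, 9); (9, 4); (4, 6); (6, 14); (14, 16); (16, 8); (8, 5); (5, 1); (1, 13)]
    (2, 11)).
- exact: (@hedge_braid 13 22).
- exact: (@hedge_braid 13 1).
Qed.

Lemma family_through_8 : exists2 B, refl_family rho B & B (vtx 3) (vtx 10) = U 8.
Proof.
have commute_12_18 : commute (U 8) (t 12 18).
  have := @commute_hexagon 8 20 19 21 17 18 27.
  rewrite (@hedge_tperm 20 10 18) // (@hedge_tperm 19 10 12) //.
  by rewrite tperm_vtxJ //; apply=> //; apply: (gen_commute uC).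
apply: (@refl_family_exists _ _ _ _ _ _ (vtx 12) (vtx 2)).
- exact: (@uniq_vtx [:: 3; 10; 12]).
- exact: (@uniq_vtx [:: 3; 10; 2]).
- exact: gen_square.
- by apply: (@commute_stabilizer 8 3 10 2 [:: (2, 7); (7, 11); (11, 12); (12, 18);
    (18, 17); (17, 9); (9, 4); (4, 6); (6, 14); (14, 16); (16, 8); (8, 5); (5, 1); (1, 13);
    (13, 15)] (12, 18)).
- exact: (@hedge_braid 8 19).
- exact: (@hedge_braid 8 6).
Qed.

Section Hexagons.
Variables A B : 'I_18 -> 'I_18 -> G.
Hypothesis A_family : refl_family rho A.
Hypothesis B_family : refl_family rho B.
Hypothesis A13 : A (vtx 7) (vtx 15) = U 13.
Hypothesis B8 : B (vtx 3) (vtx 10) = U 8.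

Lemma refl_vtxJ (C : 'I_18 -> 'I_18 -> G) a b c d : refl_family rho C ->
  is_vertex a -> is_vertex b -> is_vertex c -> is_vertex d ->
  (C (vtx a) (vtx b) ^ t c d = C (vtx (swap c d a)) (vtx (swap c d b)))%g.
Proof. by case=> C_eqv _ _ _ _ *; rewrite C_eqv !tperm_vtx. Qed.

Lemma tperm_reflR (C : 'I_18 -> 'I_18 -> G) p q r : refl_family rho C ->
  all is_vertex [:: p; q; r] -> uniq [:: p; q; r] ->
  (t q r ^ C (vtx p) (vtx q) = C (vtx p) (vtx r))%g.
Proof. by case=> _ _ _ C_right _ pqr18 pqr; apply/C_right/(uniq_vtx pqr18). Qed.

Lemma tperm_reflL (C : 'I_18 -> 'I_18 -> G) p q r : refl_family rho C ->
  all is_vertex [:: p; q; r] -> uniq [:: p; q; r] ->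
  (t p r ^ C (vtx p) (vtx q) = C (vtx r) (vtx q))%g.
Proof. by case=> _ _ _ _ C_left pqr18 pqr; apply/C_left/(uniq_vtx pqr18). Qed.

Let hexJ := @hexagonJ G u uC.

Lemma gen10_tperm : U 10 = t 4 5.
Proof. by rewrite (@hexJ 9 12 25 16 11 10) // !hedgeE // !tperm_vtxJ. Qed.

Lemma gen17_tperm : U 17 = t 9 11.
Proof. by rewrite (@hexJ 18 27 20 19 21 17) // !hedgeE // !tperm_vtxJ. Qed.

Lemma gen7_tperm : U 7 = t 2 6.
Proof.
by rewrite (@hexJ 9 3 17 14 1 7) // gen17_tperm !hedgeE // !tperm_vtxJ // tpermC.
Qed.

Lemma gen23_tperm : U 23 = t 13 17.
Proof.
by rewrite (@hexJ 18 3 10 5 2 23) // gen10_tperm !hedgeE // !tperm_vtxJ // tpermC.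
Qed.

Lemma gen4_refl : U 4 = A (vtx 3) (vtx 1).
Proof.
rewrite (@hexJ 6 1 13 22 2 4) // -A13 !hedgeE // !tperm_vtxJ //.
by rewrite tperm_reflL // !refl_vtxJ.
Qed.

Lemma gen24_refl : U 24 = B (vtx 14) (vtx 18).
Proof.
rewrite (@hexJ 12 7 6 8 20 24) // gen7_tperm -B8 !hedgeE // !tperm_vtxJ //.
by rewrite tperm_reflL // !refl_vtxJ.
Qed.

Lemma gen26_refl : U 26 = B (vtx 16) (vtx 15).
Proof.
rewrite (@hexJ 25 24 27 23 22 26) // gen24_refl gen23_tperm !hedgeE //.
by rewrite tperm_reflL // !refl_vtxJ.
Qed.

Lemma gen15_hexagon4 : U 15 = (B (vtx 3) (vtx 12) ^ A (vtx 3) (vtx 8))%g.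
Proof.
rewrite (@hexJ 19 8 4 5 11 15) // gen4_refl -B8 !hedgeE // tperm_reflR //.
by do 2!rewrite [((_ ^ A _ _) ^ _)%g]conjJg !refl_vtxJ //=.
Qed.

Lemma gen15_hexagon7 : U 15 = (B (vtx 8) (vtx 15) ^ A (vtx 12) (vtx 15))%g.
Proof.
rewrite (@hexJ 16 26 13 14 21 15) // gen26_refl -A13 !hedgeE // tpermC tperm_reflL //.
by do 2!rewrite [((_ ^ A _ _) ^ _)%g]conjJg !refl_vtxJ //=.
Qed.

Lemma families_commute p q r v : uniq [:: p; q; r; v] -> commute (A p q) (B r v).
Proof.
move=> pqrv; have [f [<- <- <- <-]] :=
  perm_map_exists (uniq_vtx (s := [:: 7; 15; 3; 10]) isT isT) pqrv erefl.
case: A_family B_family => A_eqv _ _ _ _ [B_eqv _ _ _ _].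
rewrite /commute -A_eqv -B_eqv -!conjMg A13 B8; congr (_ ^ _)%g.
exact: gen_commute.
Qed.

(* The two expressions of [u_15]. *)
Lemma families_conj p q r v : uniq [:: p; q; r; v] -> (B p r ^ A p q = B q v ^ A r v)%g.
Proof.
move=> pqrv; have [f [<- <- <- <-]] :=
  perm_map_exists (uniq_vtx (s := [:: 3; 8; 12; 15]) isT isT) pqrv erefl.
case: A_family B_family => A_eqv _ _ _ _ [B_eqv _ _ _ _]; rewrite -!A_eqv -!B_eqv.
by rewrite -!conjJg -gen15_hexagon4 -gen15_hexagon7.
Qed.

Lemma retract_flat_edge (f : sheis int 18 -> G) k :
  (forall s, f (sh_lift int s) = rho s) -> is_edge k -> volt k == 0%R ->
  U k = t (edge k).1 (edge k).2 -> f (sgen (edg k)) = U k.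
Proof. by move=> f_lift k27 /eqP vk ->; rewrite sgen_edg // vk srefl0 f_lift. Qed.

Lemma retract_sgen (f : sheis int 18 -> G) : {in balanced &, {morph f : m m' / (m * m')%g}} ->
  (forall s, f (sh_lift int s) = rho s) ->
  (forall p q, f (srefl p q 1%R 0%R) = A p q) -> (forall p q, f (srefl p q 0%R 1%R) = B p q) ->
  forall j, f (sgen j) = u j.
Proof.
move=> fM f_lift fA fB j; rewrite -(edg_ord j); have := is_edge_ord j.
rewrite -mem_iota_edge; move: (j.+1) => k kin {j}.
have flat := retract_flat_edge f_lift.
have /allP cov : all [in hedges ++ [:: 10; 17; 7; 23; 4; 8; 13; 15; 24; 26]] (iota 1 27) by [].
have {kin cov} := cov k kin; rewrite mem_cat => /orP[kin|].
  have /allP volt0 : all (fun k => volt k == 0%R) hedges by vm_compute.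
  by apply: flat; rewrite ?volt0 ?is_edge_hedges ?hedgeE.
rewrite !inE; case/or4P => [/eqP->|/eqP->|/eqP->|/or4P[/eqP->|/eqP->|/eqP->|]].
- exact: (flat 10 isT isT gen10_tperm).
- exact: (flat 17 isT isT gen17_tperm).
- exact: (flat 7 isT isT gen7_tperm).
- exact: (flat 23 isT isT gen23_tperm).
- by rewrite sgen_edg // sreflC fA gen4_refl.
- by rewrite sgen_edg // fB B8.
case/or4P=> /eqP ->.
- by rewrite sgen_edg // fA A13.
- have conj15 := srefl_triangle 0%R 1%R 1%R 0%R (uniq_vtx (s := [:: 3; 8; 12]) isT isT).
  rewrite sgen_edg // -[srefl _ _ _ _]conj15 gen15_hexagon4 -fA -fB.
  by apply: (balanced_morphJ fM); apply: balanced_srefl.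
- by rewrite sgen_edg // fB gen24_refl.
- by rewrite sgen_edg // sreflC fB gen26_refl.
Qed.

End Hexagons.
End Reconstruction.

Lemma model_retraction (G : agroup) (u : 'I_27 -> G) : CRel u ->
  exists2 f : sheis int 18 -> G,
    {in balanced &, {morph f : m m' / (m * m')%g}} & forall j, f (sgen j) = u j.
Proof.
move=> uC; have [rho rho_hedges] := hpath_morphism uC.
have [A A_family A13] := family_through_13 uC rho_hedges.
have [B B_family B8] := family_through_8 uC rho_hedges.
have [f [fM f_lift fA fB]] := balanced_morphism (n := 18) isT A_family B_family
  (families_commute uC A_family B_family A13 B8)
  (families_conj uC rho_hedges A_family B_family A13 B8).
by exists f => //; apply: (retract_sgen uC rho_hedges A_family B_family A13 B8).
Qed.

(** * The presented groups inside the model *)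

Lemma CRel_ghom (G K : agroup) (u : 'I_27 -> G) (f : G -> K) :
  ghom f -> CRel u -> CRel (f \o u).
Proof.
move=> fM [sq cm br hx]; split=> [j|i j ns|i j ij sh|h h_hex] /=.
- by rewrite -fM sq; apply: (morph_mulg1 fM).
- by rewrite -!fM cm.
- by rewrite -!fM br.
- by rewrite /hex_rel /= -!fM hx.
Qed.

Lemma presentsC_lift (C : agroup) (u : 'I_27 -> C) (K : groupType) (v : 'I_27 -> K) :
  presentsC u -> @CRel (agroup_of K) v -> exists f : {gmorph C -> K}, f \o u =1 v.
Proof.
move=> [_ universal] /universal[f [[fM fu] _]].
have fM' : {morph (f : C -> K) : c d / (c * d)%g} := fM.
by exists (gmorph_of fM').
Qed.

Lemma presentsC_ext (C K : agroup) (u : 'I_27 -> C) (f g : C -> K) :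
  presentsC u -> ghom f -> ghom g -> (forall j, f (u j) = g (u j)) -> f =1 g.
Proof.
move=> [uC universal] fM gM fg c; have [h [_ h_uniq]] := universal K _ (CRel_ghom fM uC).
have <- : h = f by apply: h_uniq.
by have <- : h = g by apply: h_uniq; split=> // j; rewrite /= fg.
Qed.

Lemma presentsH_lift (H : agroup) (x y : 'I_18 -> H) (z : H) (K : groupType)
    (x' y' : 'I_18 -> K) (z' : K) : presentsH x y z -> @HRel (agroup_of K) x' y' z' ->
  exists f : {gmorph H -> K}, [/\ f \o x =1 x', f \o y =1 y' & f z = z'].
Proof.
move=> [_ universal] /universal[f [[fM fx fy fz] _]].
have fM' : {morph (f : H -> K) : g h / (g * h)%g} := fM.
by exists (gmorph_of fM').
Qed.

Lemma presentsH_ext (H K : agroup) (x y : 'I_18 -> H) (z : H) (f g : H -> K) :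
  presentsH x y z -> ghom f -> ghom g -> central (f z) ->
  (forall i, f (x i) = g (x i)) -> (forall i, f (y i) = g (y i)) -> f z = g z -> f =1 g.
Proof.
move=> [[xy_comm xy_z _] universal] fM gM fz_central fx fy fz h.
have f_comm a b : gcomm (f a) (f b) = f (gcomm a b).
  by rewrite !gcommE; have := gmulfR (gmorph_of fM) a b.
have [] := universal K (f \o x) (f \o y) (f z); last first.
  move=> k [_ k_uniq]; have <- : k = f by apply: k_uniq.
  by have <- : k = g by apply: k_uniq; split=> // i; rewrite /= ?fx ?fy.
split=> //= [i j ij|i]; last by rewrite f_comm xy_z.
have [xx yy xy] := xy_comm i j ij.
by rewrite !f_comm xx yy xy; split; apply: (morph_mulg1 fM).
Qed.

Lemma sgen_generate (P : sheis int 18 -> Prop) : subgroup P -> (forall j, P (sgen j)) ->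
  forall m, m \in balanced -> P m.
Proof.
move=> subP P_sgen.
have P_lift s : P (sh_lift int s).
  have P_edge :
    {in zip hpath (behead hpath), forall e, P (sh_lift int (tperm (vtx e.1) (vtx e.2)))}.
    have /allP flat : all (fun e => has (fun k => joins k e.1 e.2 && (volt k == 0%R)) hedges)
      (zip hpath (behead hpath)) by vm_compute.
    move=> e /flat /hasP[k kin /andP[k_e /eqP vk]].
    rewrite -(tperm_edgeE (is_edge_hedges kin) k_e); have := P_sgen (edg k).
    by rewrite sgen_edg ?is_edge_hedges // vk srefl0 /tperm_edge !ep_edg ?is_edge_hedges.
  have subP_lift : subgroup (P \o @sh_lift int 18) := subgroup_preim _ subP.
  by apply: (subgroup_fixing subP_lift (avoid := [::]) (r := 3) _ P_edge).
have P_refl a b k l p q : uniq [:: a; b] -> p != q -> P (srefl a b k l) -> P (srefl p q k l).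
  move=> ab pq Pab.
  have [||f [<- <-]] := @perm_map_exists _ [:: a; b] [:: p; q] _ _ erefl; try distinct.
  by rewrite -sreflJ; apply: subgroupJ.
apply: balanced_ind => // p q pq.
  apply: (P_refl (vtx 7) (vtx 15)) => //; first exact: (uniq_vtx (s := [:: 7; 15])).
  by have := P_sgen (edg 13); rewrite sgen_edg.
apply: (P_refl (vtx 3) (vtx 10)) => //; first exact: (uniq_vtx (s := [:: 3; 10])).
by have := P_sgen (edg 8); rewrite sgen_edg.
Qed.

Lemma model_embedding (C : agroup) (u : 'I_27 -> C) : presentsC u ->
  exists f : {gmorph C -> sheis int 18},
    [/\ f \o u =1 sgen, injective f & forall m, m \in balanced <-> exists c, f c = m].
Proof.
move=> HC; have [uC _] := HC; have [f fu] := presentsC_lift HC sgen_CRel.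
have f_balanced c : f c \in balanced.
  apply/eqP; apply: (@presentsC_ext _ (ZmodGroup (int * int)%type) u
    (fun c => heis_ab (sh_heis (f c))) (fun=> 0%R) HC) => [a b|a b|j].
  - by rewrite [f (a ** b)]gmulfM heis_abM heis_ab_perm.
  - by rewrite /gmul /= addr0.
  - by rewrite [f (u j)]fu; apply: (eqP (balanced_srefl _ _ _ _)).
have [g gM gu] := model_retraction uC.
have fK c : g (f c) = c.
  apply: (@presentsC_ext _ _ u (g \o f) id HC) => [a b|//|j] /=; last by rewrite [f (u j)]fu gu.
  by rewrite [f (a ** b)]gmulfM; apply: gM (f_balanced a) (f_balanced b).
exists f; split=> //; first exact: can_inj fK.
move=> m; split=> [|[c <-]]; last exact: f_balanced.
apply: (@sgen_generate (fun m => exists c, f c = m)) => [|j]; last by exists (u j); apply: fu.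
split=> [|_ _ [c <-] [d <-]|_ [c <-]].
- by exists 1%g; apply: gmulf1.
- by exists (c * d)%g; apply: gmulfM.
- by exists c^-1%g; apply: gmulfV.
Qed.

Section StandardGenerators.
Local Open Scope ring_scope.
Variable n : nat.

Definition heisx (i : 'I_n) : heis int n := Heis (delta_mx 0 i) 0 0.
Definition heisy (i : 'I_n) : heis int n := Heis 0 (delta_mx 0 i) 0.
Definition heisz : heis int n := Heis 0 0 1.

Lemma heis_word_std a b c : heis_word heisx heisy heisz a b c = Heis a b c.
Proof.
rewrite /heis_word -heis_xyz -[c in RHS]intz (exponentialMz (@exponential_heis_z _ _)).
congr (_ * _ * _)%g.
  move: a; apply: exponential_rV_ext => [||i]; last by rewrite prodz_delta.
    by apply: prodzD => i j; rewrite /commute !heisM !dot0r addrC.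
  exact: exponential_heis_x.
move: b; apply: exponential_rV_ext => [||i]; last by rewrite prodz_delta.
  by apply: prodzD => i j; rewrite /commute !heisM !dot0l [delta_mx 0 j + _]addrC.
exact: exponential_heis_y.
Qed.

End StandardGenerators.

Lemma balanced_heisz n : sh_incl (heisz n) \in balanced.
Proof. by rewrite inE /= /heis_ab /= rsum0. Qed.

Lemma HRel_heis : @HRel (agroup_of (heis int 18)) (@heisx 18) (@heisy 18) (heisz 18).
Proof.
have gcomm_heis g h : gcomm (g : agroup_of (heis int 18)) h
    = Heis 0 0 (dot (hx g) (hy h) - dot (hx h) (hy g))%R.
  by rewrite gcommE; apply: heis_commg.
split=> [i j ij|i|h]; last by rewrite /gmul /= commute_heis_z.
  rewrite !gcomm_heis /= !dot0l !dot0r dot_deltal mxE (negPf ij).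
  by rewrite andbF subrr.
by rewrite gcomm_heis /= dot0l dot_deltal mxE !eqxx.
Qed.

Section HeisenbergRelations.
Variables (H : agroup) (x y : 'I_18 -> H) (z : H).
Hypothesis xyz : HRel x y z.

Definition heis_map (h : heis int 18) : H := heis_word x y z (hx h) (hy h) (hz h).

Let commute_of (a b : H) : gcomm a b = gone -> commute a b.
Proof. by rewrite gcommE => ab; apply/commgP/eqP. Qed.

Lemma heis_mapM : {morph heis_map : g h / (g * h)%g}.
Proof.
case: xyz => [comm xy_z z_central] g h; rewrite /heis_map.
rewrite (heis_wordM (form := @dot _ _)) //.
- by move=> i j; have [->//|/comm[/commute_of]] := eqVneq i j.
- by move=> i j; have [->//|/comm[_ /commute_of]] := eqVneq i j.
- by move=> i; apply: z_central.
- by move=> i; apply: z_central.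
- exact: dotDl.
- exact: dotDr.
move=> i j; rewrite dot_deltal mxE -gcommE; have [<-|ij] := eqVneq i j.
  by rewrite eqxx xy_z.
by have [_ _ ->] := comm i j ij.
Qed.

Lemma heis_map_gen :
  [/\ forall i, heis_map (heisx i) = x i, forall i, heis_map (heisy i) = y i &
      heis_map (heisz 18) = z].
Proof.
have prodz0 w : prodz w 0%R = 1%g :> H.
  by apply: big1 => i _; rewrite mxE.
rewrite /heis_map /heis_word; split=> [i|i|] /=; rewrite ?prodz0 ?prodz_delta ?expgz1.
- by rewrite !mulg1.
- by rewrite mul1g mulg1.
- by rewrite !mul1g.
Qed.

End HeisenbergRelations.

Lemma presentsH_heis (H : agroup) (x y : 'I_18 -> H) (z : H) : presentsH x y z ->
  exists F : {gmorph H -> heis int 18},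
    [/\ bijective F, F \o x =1 @heisx 18, F \o y =1 @heisy 18 & F z = heisz 18].
Proof.
move=> HH; have [xyz _] := HH; have [F [Fx Fy Fz]] := presentsH_lift HH HRel_heis.
exists F; split=> //; exists (heis_map x y z) => [h|[a b c]].
  have [Nx Ny Nz] := heis_map_gen x y z.
  apply: (@presentsH_ext _ _ x y z (heis_map x y z \o F) id HH) => [g g'|//||i|i|] /=.
  - by rewrite [F (g ** g')]gmulfM; apply: heis_mapM.
  - by rewrite Fz Nz; case: xyz.
  - by rewrite [F (x i)]Fx Nx.
  - by rewrite [F (y i)]Fy Ny.
  - by rewrite Fz Nz.
by rewrite /heis_map gmulf_heis_word (eq_heis_word _ _ _ _ Fx Fy) Fz heis_word_std.
Qed.

(** * The centre and the abelian quotient *)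

Lemma perm_center_triv (T : finType) (s : {perm T}) : 2 < #|T| ->
  (forall t : {perm T}, commute s t) -> s = 1%g.
Proof.
move=> T3 s_central; apply/permP => i; rewrite perm1; apply/eqP/negPn/negP => si.
have [k kP] := exists_notin (s := [:: i; s i]) T3.
have /(congr1 (fun t : {perm T} => t i)) := s_central (tperm (s i) k).
by rewrite !permM tpermL tpermD; [move=> e; move: kP; rewrite e !inE eqxx orbT | distinct..].
Qed.

Section CentreOfModel.
Local Open Scope ring_scope.
Variable n : nat.
Implicit Types (a : 'rV[int]_n) (m : sheis int n).

Lemma row_perm_invariant a : (0 < n)%N -> rsum a = 0 ->
  (forall s : {perm 'I_n}, a *m perm_mx s = a) -> a = 0.
Proof.
move=> n_gt0 a0 a_inv; pose o := Ordinal n_gt0.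
have a_const i : a 0 i = a 0 o.
  by have := dot_perm (tperm o i) a (delta_mx 0 o); rewrite a_inv delta_perm !dot_deltar tpermL.
have ao : a 0 o = 0.
  move: a0; rewrite rsumE; under eq_bigr => i _ do rewrite a_const.
  by rewrite sumr_const card_ord => /eqP; rewrite mulrn_eq0 eqn0Ngt n_gt0 => /eqP.
by apply/rowP => i; rewrite a_const ao mxE.
Qed.

Lemma balanced_center m : (2 < n)%N -> m \in balanced ->
  (forall s, commute m (sh_lift int s)) -> exists c, m = sh_incl (Heis 0 0 c).
Proof.
case: m => s [a b c] n_gt2; rewrite balancedE /= => /andP[/eqP a0 /eqP b0] m_central.
have s_eq1 : s = 1%g.
  apply: perm_center_triv; rewrite ?card_ord // => t.
  exact: (gmulf_commute (@sh_perm int n) (m_central t)).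
have inv t : heis_perm t (Heis a b c) = Heis a b c.
  by have := congr1 (@sh_heis _ _) (m_central t); rewrite /= gmulf1 mulg1 mul1g.
have n_gt0 : (0 < n)%N by apply: ltn_trans n_gt2.
have a_eq0 : a = 0 := row_perm_invariant n_gt0 a0 (fun t => congr1 (@hx _ _) (inv t)).
have b_eq0 : b = 0 := row_perm_invariant n_gt0 b0 (fun t => congr1 (@hy _ _) (inv t)).
by exists c; rewrite s_eq1 a_eq0 b_eq0.
Qed.

End CentreOfModel.

Section AbelianQuotient.
Local Open Scope ring_scope.
Variables (R : comNzRingType) (n : nat).
Implicit Types (a : 'rV[R]_(1 + n)) (g h : heis R (1 + n)).

Lemma rsum_row_mx (c : 'rV[R]_1) (b : 'rV[R]_n) : rsum (row_mx c b) = c 0 0 + rsum b.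
Proof.
rewrite !rsumE big_split_ord big_ord1 row_mxEl; congr (_ + _).
by apply: eq_bigr => i _; rewrite row_mxEr.
Qed.

Lemma rsubmx_eq0 a : rsum a = 0 -> rsubmx a = 0 -> a = 0.
Proof.
rewrite -[a]hsubmxK row_mxKr rsum_row_mx => a0 b0; rewrite b0 rsum0 addr0 in a0 *.
by apply/rowP => i; rewrite -(splitK i); case: split => j /=;
  rewrite ?row_mxEl ?row_mxEr ?ord1 ?a0 !mxE.
Qed.

Lemma rsubmx_surj (b : 'rV[R]_n) : exists2 a : 'rV[R]_(1 + n), rsum a = 0 & rsubmx a = b.
Proof.
exists (row_mx (const_mx (- rsum b)) b); last exact: row_mxKr.
by rewrite rsum_row_mx mxE addNr.
Qed.

Definition heis_coords h : 'rV[R]_(n + n) := row_mx (rsubmx (hx h)) (rsubmx (hy h)).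

Lemma heis_coordsM g h : heis_coords (g * h)%g = heis_coords g + heis_coords h.
Proof. by rewrite /heis_coords add_row_mx -!linearD. Qed.

Lemma heis_coords_eq0 h : heis_ab h = 0 ->
  heis_coords h = 0 <-> exists c, h = Heis 0 0 c.
Proof.
move=> [x0 y0]; split=> [h0|[c ->]]; last by rewrite /heis_coords !linear0 row_mx0.
exists (hz h); apply: heis_eq => //=; apply: rsubmx_eq0 => //.
  by have := congr1 lsubmx h0; rewrite row_mxKl linear0.
by have := congr1 rsubmx h0; rewrite row_mxKr linear0.
Qed.

Lemma heis_coords_surj (v : 'rV[R]_(n + n)) : exists2 h, heis_ab h = 0 & heis_coords h = v.
Proof.
have [a a0 ea] := rsubmx_surj (lsubmx v); have [b b0 eb] := rsubmx_surj (rsubmx v).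
by exists (Heis a b 0); rewrite /heis_ab /heis_coords /= ?a0 ?b0 // ea eb hsubmxK.
Qed.

End AbelianQuotient.

(** * The structure of [C] *)

Lemma unique_factorization (G K : groupType) (psi : {gmorph G -> K}) (L : G -> Prop) :
  (forall a b, L a -> L b -> psi a = psi b -> a = b) ->
  (forall s, exists a, L a /\ psi a = s) ->
  forall c, exists! kl : G * G, [/\ psi kl.1 = 1%g, L kl.2 & c = (kl.1 * kl.2)%g].
Proof.
move=> L_inj L_surj c; have [l [Ll psi_l]] := L_surj (psi c).
exists ((c * l^-1)%g, l); split=> [|[k' l'] /= [psi_k' Ll' ec]].
  by split=> //=; rewrite ?mulgVK // gmulfM gmulfV psi_l mulgV.
suff el : l' = l by rewrite ec el mulgK.
by apply: L_inj => //; rewrite psi_l ec gmulfM psi_k' mul1g.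
Qed.

Lemma psi_sh_perm (C : agroup) (u : 'I_27 -> C) (f : {gmorph C -> sheis int 18})
    (psi : C -> PermGroup) : presentsC u -> f \o u =1 sgen -> ghom psi ->
  (forall j, psi (u j) = tperm (ep1 j) (ep2 j)) -> psi =1 @sh_perm _ _ \o f.
Proof.
move=> HC f_u psi_hom psi_u; apply: (presentsC_ext HC psi_hom) => [c d|j] /=.
  by rewrite [f (c ** d)]gmulfM.
by rewrite psi_u [f (u j)]f_u.
Qed.

Section HeisenbergTransport.
Local Open Scope ring_scope.
Variables (H : agroup) (x y : 'I_18 -> H) (z : H) (F : {gmorph H -> heis int 18}).
Hypothesis H_presented : presentsH x y z.
Hypothesis F_x : F \o x =1 @heisx 18.
Hypothesis F_y : F \o y =1 @heisy 18.
Hypothesis F_z : F z = heisz 18.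

Lemma heis_perm_transport (act : {perm 'I_18} -> H -> H) : (forall s, ghom (act s)) ->
  (forall s i, act s (x i) = x (s i)) -> (forall s i, act s (y i) = y (s i)) ->
  (forall s, act s z = z) -> forall s h, F (act s h) = heis_perm s (F h).
Proof.
move=> actM act_x act_y act_z s; apply: (@presentsH_ext _ (agroup_of (heis int 18)) x y z
  (F \o act s) (heis_perm s \o F) H_presented) => [g h|g h||i|i|] /=.
- by rewrite actM [F (_ ** _)]gmulfM.
- by rewrite [F (_ ** _)]gmulfM heis_perm_mul.
- by rewrite act_z F_z => h; rewrite /gmul /= commute_heis_z.
- by rewrite act_x ![F (x _)]F_x /heisx /heis_perm /= delta_perm mul0mx.
- by rewrite act_y ![F (y _)]F_y /heisy /heis_perm /= delta_perm mul0mx.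
- by rewrite act_z F_z /heisz /heis_perm /= mul0mx.
Qed.

Variable ab : H -> Z2.
Hypothesis abM : ghom ab.
Hypothesis ab_x : forall i, ab (x i) = xZ.
Hypothesis ab_y : forall i, ab (y i) = yZ.
Hypothesis ab_z : ab z = 0.

Lemma heis_abE h : ab h = (heis_ab (F h)).1 *: xZ + (heis_ab (F h)).2 *: yZ.
Proof.
move: h; apply: (presentsH_ext H_presented abM) => [g h|h|i|i|].
- by rewrite [F (_ ** _)]gmulfM heis_abM /= !scalerDl addrACA.
- exact: addrC.
- by rewrite ab_x [F (x i)]F_x /= rsum_delta rsum0 scale1r scale0r addr0.
- by rewrite ab_y [F (y i)]F_y /= rsum_delta rsum0 scale1r scale0r add0r.
- by rewrite ab_z F_z /= rsum0 !scale0r addr0.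
Qed.

Lemma heis_ab_eq0 h : ab h = 0 <-> heis_ab (F h) = 0.
Proof.
rewrite heis_abE; split=> [/rowP ab0|->]; last by rewrite !scale0r addr0.
have := ab0 ord0; have := ab0 (inord 1); rewrite !mxE /= -!val_eqE /= inordK //=.
rewrite !mulr1 !mulr0 addr0 add0r => ab1 ab2.
by rewrite /heis_ab ab1 ab2.
Qed.

End HeisenbergTransport.

Section Splitting.
Local Open Scope ring_scope.
Variables (C : agroup) (u : 'I_27 -> C) (f : {gmorph C -> sheis int 18}).
Hypothesis f_u : f \o u =1 sgen.
Hypothesis f_inj : injective f.
Hypothesis f_balanced : forall m, m \in balanced <-> exists c, f c = m.
Variable psi : {gmorph C -> {perm 'I_18}}.
Hypothesis psiE : forall c, psi c = sh_perm (f c).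

Definition generated_by_T0 : C -> Prop := gen_sub (fun c => exists2 j, j \in T0 & c = u j).

Lemma psi_gen j : psi (u j) = tperm (ep1 j) (ep2 j).
Proof. by rewrite psiE [f (u j)]f_u. Qed.

Definition T0_labels : seq nat :=
  [:: 5; 6; 8; 9; 11; 12; 14; 16; 18; 19; 20; 21; 22; 24; 25; 26; 27]%N.

(* The edges of the spanning tree, oriented, in an order in which each one starts at
   a vertex already reached. *)
Definition T0_tree : seq (nat * (nat * nat)) :=
  [:: (5, (1, 5)); (11, (5, 8)); (16, (8, 16)); (25, (16, 14)); (24, (14, 18)); (20, (18, 10));
      (8, (10, 3)); (6, (3, 2)); (19, (10, 12)); (21, (12, 11)); (14, (11, 7)); (12, (14, 6));
      (9, (6, 4)); (26, (16, 15)); (22, (15, 13)); (27, (18, 17)); (18, (17, 9))]%N.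

Lemma T0_gauge : exists phi chi, forall a, generated_by_T0 a -> f a = gauge phi chi (psi a).
Proof.
have [phi [chi sgenE]] := @sgen_gauge (unzip1 T0_tree) isT.
exists phi, chi => a; elim: a / => [|_ [j jT0 ->]|a b _ IHa _ IHb|a _ IHa].
- by rewrite !gmulf1.
- rewrite [f (u j)]f_u psi_gen; case/mapP: jT0 => k kin ->.
  by rewrite sgenE //; move: k kin; apply/allP.
- by rewrite ![_ (a ** b)]gmulfM IHa IHb gmulfM.
- by rewrite ![_ (ginv a)]gmulfV IHa gmulfV.
Qed.

Lemma T0_injective a b : generated_by_T0 a -> generated_by_T0 b -> psi a = psi b -> a = b.
Proof.
have [phi [chi fE]] := T0_gauge; move=> La Lb ab; apply: f_inj.
by rewrite (fE a La) (fE b Lb) ab.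
Qed.

Lemma T0_surjective (s : {perm 'I_18}) : exists a, generated_by_T0 a /\ psi a = s.
Proof.
pose P s := exists a, generated_by_T0 a /\ psi a = s.
have subP : subgroup P.
  split=> [|_ _ [a [La <-]] [b [Lb <-]]|_ [a [La <-]]].
  - by exists 1%g; split; [apply: gen_one | apply: gmulf1].
  - by exists (a * b)%g; split; [apply: gen_mul | apply: gmulfM].
  - by exists a^-1%g; split; [apply: gen_inv | apply: gmulfV].
apply: (subgroup_fixing subP (avoid := [::]) (r := 1%N) (es := unzip2 T0_tree)) => //.
move=> _ /mapP[[k e] ke_tree ->] /=.
have /allP tree_ok : all (fun ke =>
  [&& is_edge ke.1, ke.1 \in T0_labels & joins ke.1 ke.2.1 ke.2.2]) T0_tree by [].
have /and3P[/= k27 kT0 k_e] := tree_ok _ ke_tree; exists (u (edg k)); split.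
  by apply: gen_in; exists (edg k) => //; apply: map_f.
by rewrite psi_gen -(tperm_edgeE k27 k_e).
Qed.

Section HeisenbergComponent.
Variables (H : agroup) (F : {gmorph H -> heis int 18}) (N : heis int 18 -> H).
Hypothesis FK : cancel F N.
Hypothesis NK : cancel N F.
Variable ab : H -> Z2.
Hypothesis ab_eq0 : forall h, ab h = 0 <-> heis_ab (F h) = 0.
Variable act : {perm 'I_18} -> H -> H.
Hypothesis F_act : forall s h, F (act s h) = heis_perm s (F h).

Definition heis_comp (c : C) : H := N (sh_heis (f c)).

Lemma F_heis_comp c : F (heis_comp c) = sh_heis (f c).
Proof. exact: NK. Qed.

Lemma heis_compM c d : heis_comp (c ** d) = act (psi d) (heis_comp c) ** heis_comp d.
Proof.
apply: (can_inj FK); rewrite [RHS]gmulfM F_act !F_heis_comp [f (c ** d)]gmulfM psiE.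
by [].
Qed.

Lemma ab_heis_comp c : ab (heis_comp c) = 0.
Proof. by apply/ab_eq0; rewrite F_heis_comp; apply/eqP/f_balanced; exists c. Qed.

Lemma psi_heis_comp_inj c d : psi c = psi d -> heis_comp c = heis_comp d -> c = d.
Proof.
move=> psi_cd /(congr1 F); rewrite !F_heis_comp => heis_cd.
by apply/f_inj/sheis_eq => //; rewrite -!psiE.
Qed.

Lemma psi_heis_comp_surj (s : {perm 'I_18}) k : ab k = 0 -> exists c, psi c = s /\ heis_comp c = k.
Proof.
move=> /ab_eq0 k0; have [c fc] : exists c, f c = SHeis s (F k).
  by apply/f_balanced; rewrite inE /= k0.
by exists c; split; [rewrite psiE fc | apply: (can_inj FK); rewrite F_heis_comp fc].
Qed.

Lemma psi_heis_comp_unique (s : {perm 'I_18}) k : ab k = 0 ->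
  exists! c, psi c = s /\ heis_comp c = k.
Proof.
move=> /(psi_heis_comp_surj s)[c [psi_c c_k]]; exists c; split=> // d [psi_d d_k].
by apply: psi_heis_comp_inj; rewrite ?psi_c ?c_k.
Qed.

Lemma heis_comp_kernel_iso : iso_on heis_comp (@gker C PermGroup psi) (gker ab).
Proof.
split=> [a b _ psi_b|a _|a b psi_a psi_b|h ab_h].
- rewrite heis_compM; congr (_ ** _); apply: (can_inj FK).
  by rewrite F_act (psi_b : psi b = 1%g) heis_perm1.
- exact: ab_heis_comp.
- by apply: psi_heis_comp_inj; rewrite [LHS]psi_a [RHS]psi_b.
- by have [c [psi_c c_h]] := psi_heis_comp_surj 1%g ab_h; exists c.
Qed.

End HeisenbergComponent.

Section Centre.
Variable zC : C.
Hypothesis f_zC : f zC = sh_incl (heisz 18).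

Lemma f_gpow n : f (gpow zC n) = sh_incl (Heis 0 0 n).
Proof.
by rewrite gpowE gmulfXz f_zC -gmulfXz -(exponentialMz (@exponential_heis_z _ _)) intz.
Qed.

Lemma gpow_zC_eq1 n : gpow zC n = gone -> n = 0.
Proof. by move=> /(congr1 f); rewrite f_gpow [RHS]gmulf1 => -[]. Qed.

Lemma f_heis_z c : (exists n, f c = sh_incl (Heis 0 0 n)) <-> exists n, c = gpow zC n.
Proof.
by split=> -[n cn]; exists n; [apply: f_inj; rewrite f_gpow | rewrite cn f_gpow].
Qed.

Lemma central_gpow c : central c <-> exists n, c = gpow zC n.
Proof.
rewrite -f_heis_z; split=> [c_central|[n fc] d]; last first.
  by apply: f_inj; rewrite ![f (_ ** _)]gmulfM fc; apply/commute_sym/commute_sheis_z.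
apply: balanced_center => // [|s]; first by apply/f_balanced; exists c.
have [d fd] : exists d, f d = sh_lift int s by apply/f_balanced/balanced_lift.
by rewrite -fd; apply: gmulf_commute; apply: c_central.
Qed.

Definition coords (c : C) : Z34 := @heis_coords int 17 (sh_heis (f c)).

Lemma coordsM a b : psi b = 1%g -> coords (a ** b) = coords a ** coords b.
Proof.
move=> psi_b; rewrite /coords [f (a ** b)]gmulfM.
rewrite [sh_heis _](_ : _ = (sh_heis (f a) * sh_heis (f b))%g) ?heis_coordsM //.
by rewrite /= -psiE psi_b heis_perm1.
Qed.

Lemma coords_surj (v : Z34) : exists2 a, psi a = 1%g & coords a = v.
Proof.
have [h h0 hv] := @heis_coords_surj int 17 v.
have [c fc] : exists c, f c = sh_incl h by apply/f_balanced; rewrite inE /= h0.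
by exists c; [rewrite psiE fc | rewrite /coords fc].
Qed.

Lemma coords_eq1 a : psi a = 1%g -> coords a = gone <-> exists n, a = gpow zC n.
Proof.
move=> psi_a; rewrite -f_heis_z.
have a0 : heis_ab (sh_heis (f a)) = 0 by apply/eqP/f_balanced; exists a.
rewrite [coords a = gone](@heis_coords_eq0 int 17 _ a0).
split=> -[n an]; exists n; last by rewrite an.
by apply: sheis_eq; rewrite //= -psiE psi_a.
Qed.

End Centre.
End Splitting.

Theorem theorem1p1
  (C : agroup) (u : 'I_27 -> C) (HC : presentsC u)
  (psi : C -> PermGroup) (psi_hom : ghom psi)
  (psi_u : forall j, psi (u j) = tperm (ep1 j) (ep2 j))
  (H : agroup) (x y : 'I_18 -> H) (z : H) (HH : presentsH x y z)
  (ab : H -> Z2) (ab_hom : ghom ab)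
  (ab_x : forall i, ab (x i) = xZ) (ab_y : forall i, ab (y i) = yZ)
  (ab_z : ab z = 0%R)
  (act : {perm 'I_18} -> H -> H) (act_hom : forall s, ghom (act s))
  (act_x : forall s i, act s (x i) = x (s i))
  (act_y : forall s i, act s (y i) = y (s i))
  (act_z : forall s, act s z = z) :
  (* (i) *)
  ((forall s : PermGroup, exists c, psi c = s) /\
   (let L := gen_sub (fun c : C => exists2 j, j \in T0 & c = u j) in
    [/\ (forall a b, L a -> L b -> psi a = psi b -> a = b),
        (forall s : PermGroup, exists a, L a /\ psi a = s) &
        (forall c : C, exists! kl : C * C,
            [/\ gker psi kl.1, L kl.2 & c = kl.1 ** kl.2])])) /\
  (* (ii) *)
  (exists f : C -> H, iso_on f (gker psi) (gker ab)) /\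
  (exists phi : C -> H,
     [/\ (forall c, ab (phi c) = 0%R),
         (forall c d, phi (c ** d) = act (psi d) (phi c) ** phi d),
         (forall (s : PermGroup) (k : H), ab k = 0%R ->
             exists! c, psi c = s /\ phi c = k) &
  (* (iii) *)
         (exists zC : C,
            [/\ psi zC = gone, phi zC = z,
                (forall n, gpow zC n = gone -> n = 0%R),
                (forall c, central c <-> exists n, c = gpow zC n) &
                (exists q : C -> Z34,
                   [/\ (forall a b, gker psi a -> gker psi b -> q (a ** b) = q a ** q b),
                       (forall v : Z34, exists2 a, gker psi a & q a = v) &
                       (forall a, gker psi a -> (q a = gone <-> exists n, a = gpow zC n))])])]).
Proof.
have [f [f_u f_inj f_balanced]] := model_embedding HC.
have [F [[N FK NK] F_x F_y F_z]] := presentsH_heis HH.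
have psiE : (gmorph_of psi_hom : {gmorph C -> {perm 'I_18}}) =1 @sh_perm _ _ \o f.
  exact: psi_sh_perm HC f_u psi_hom psi_u.
have [zC f_zC] : exists zC, f zC = sh_incl (heisz 18) := (f_balanced _).1 (balanced_heisz 18).
have ab_eq0 := heis_ab_eq0 HH F_x F_y F_z ab_hom ab_x ab_y ab_z.
have F_act := heis_perm_transport HH F_x F_y F_z act_hom act_x act_y act_z.
have T0_surj := T0_surjective f_u psiE; have T0_inj := T0_injective f_u f_inj psiE.
split; [|split].
- split=> [s|]; first by have [a [_ <-]] := T0_surj s; exists a.
  by split; [apply: T0_inj | apply: T0_surj | apply: (unique_factorization T0_inj T0_surj)].
- exists (heis_comp f N).
  exact: (heis_comp_kernel_iso f_inj f_balanced psiE FK NK ab_eq0 F_act).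
exists (heis_comp f N); split; first exact: (ab_heis_comp f_balanced NK ab_eq0).
- exact: (heis_compM psiE FK NK F_act).
- exact: (psi_heis_comp_unique f_inj f_balanced psiE FK NK ab_eq0).
exists zC; split; [by rewrite [LHS]psiE /= f_zC | by rewrite /heis_comp f_zC -F_z FK | | |].
- exact: (gpow_zC_eq1 f_zC).
- exact: (central_gpow f_inj f_balanced f_zC).
exists (coords f); split=> [a b _|v|a]; first exact: (coordsM psiE).
- exact: (coords_surj f_balanced psiE).
- exact: (coords_eq1 f_inj f_balanced psiE f_zC).
Qed.
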